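(* Let $n$ and $k$ be positive integers, let $A$ be a subset of $[k]^{n}$, and let $B$ be the initial segment of the $\leq$-order in $[k]^{n}$ with $|B|=|A|$. Then $|d(A)|\geq|d(B)|$.
   Context: Here $[k]=\{0,1,\dots,k-1\}$ and $[k]^{n}=\{0,\dots,k-1\}^{n}$ is the set of sequences $x=x_{1}\dots x_{n}$ with each $x_i\in[k]$. $d$-shadow: for $x\in[k]^{n}$, $d(\{x\})$ is the set of all points obtained from $x$ by changing exactly one non-zero coordinate of $x$ (i.e. one coordinate with value in $\{1,\dots,k-1\}$) to $0$. For $A\subseteq[k]^{n}$, $d(A)=\bigcup_{x\in A}d(\{x\})$. For example $d(\{012\})=\{002,010\}$ and $d(\{000\})=\emptyset$. The $\leq$-order: for $x\in[k]^{n}$ and $i\in[k]$ let $R_{i}(x)=\{j\in\{1,\dots,n\}:x_{j}=i\}$. The total order $\leq$ on $[k]^{n}$ is defined by setting $x\leq y$ if $x=y$ or one of the following holds: (1) $|R_{0}(x)|>|R_{0}(y)|$; (2) $|R_{0}(x)|=|R_{0}(y)|$ and, for the largest $i$ satisfying $R_{i}(x)\neq R_{i}(y)$, we have $\max\left(R_{i}(x)\,\Delta\,R_{i}(y)\right)\in R_{i}(y)$, where $\Delta$ denotes symmetric difference. An initial segment of the $\leq$-order in $[k]^n$ is a set $B\subseteq[k]^{n}$ such that $y\in B$, $x\in[k]^n$ and $x\leq y$ imply $x\in B$. *)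

(* Defs.v *)
From mathcomp Require Import all_boot.

Set Implicit Arguments.
Unset Strict Implicit.
Unset Printing Implicit Defensive.

(* [k]^n. Coordinates are numbered 0, ..., n-1 rather than 1, ..., n; only
   their relative order matters below. *)
Notation points k n := {ffun 'I_n -> 'I_k}.

Section Shadow.
Variables k n : nat.
Implicit Types (x y : points k n) (A B : {set points k n}).

Definition shadow1 x : {set points k n} :=
  [set y : points k n | [exists j : 'I_n,
     [&& x j != 0 :> nat, y j == 0 :> nat &
         [forall i : 'I_n, (i != j) ==> (y i == x i)]]]].

Definition shadow A : {set points k n} := \bigcup_(x in A) shadow1 x.

(* The value i is a nat, so that level 0 x makes sense without assuming k > 0. *)
Definition level (i : nat) x : {set 'I_n} := [set j | x j == i :> nat].

Definition symdiff (S T : {set 'I_n}) : {set 'I_n} := (S :\: T) :|: (T :\: S).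

Definition is_max_of (S : {set 'I_n}) (j : 'I_n) : Prop :=
  j \in S /\ forall j' : 'I_n, j' \in S -> j' <= j.

Definition is_last_diff x y (i : 'I_k) : Prop :=
  level i x <> level i y /\
  forall i' : 'I_k, level i' x <> level i' y -> i' <= i.

Definition point_le x y : Prop :=
  [\/ x = y,
      #|level 0 x| > #|level 0 y|
    | #|level 0 x| = #|level 0 y| /\
      exists i : 'I_k, is_last_diff x y i /\
        exists j : 'I_n, is_max_of (symdiff (level i x) (level i y)) j /\
                         j \in level i y].

Definition initial_segment B : Prop :=
  forall x y, y \in B -> point_le x y -> x \in B.

End Shadow.

(* Main.v *)
(** Identify a point with the set of pairs (value, coordinate) it takes at its
    non-zero coordinates; the order compares the number of pairs first and then
    the sets of pairs colexicographically, so it is the order of the additive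
    weight [key].  A point with a zero coordinate has a least cover, obtained by
    setting its first zero to 1, hence the shadow of an initial segment [B] has
    size [\sum_(b in B) nu b], where [nu b] counts the coordinates of value 1
    preceded by non-zero coordinates only; for arbitrary [A] this sum is a lower
    bound for the size of the shadow.

    Inducting on the set [S] of coordinates allowed to be non-zero, replace each
    slice of [A] along a coordinate by an initial segment.  This does not
    enlarge the shadow, and choosing [A] with least total key makes it stable
    under all such compressions.  If then [x] is in [B] but not in [A] and [y] in
    [A] but not in [B], no point between [x] and [y] shares a coordinate of [S]
    with both.  This forces [nu x <= nu y], except for very special pairs without
    zero coordinates; when [#|S| > 2] one such pair forces the sum of [nu] over
    [B :\: A] to be at most 1 and that over [A :\: B] to be positive.  For
    [#|S| = 2] the claim is that a grid filled in square-like fashion minimises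
    the semiperimeter. *)

Require Import Defs.
From mathcomp Require Import all_boot.
From mathcomp Require Import zify.

Set Implicit Arguments.
Unset Strict Implicit.
Unset Printing Implicit Defensive.

(** * Bounds on sums over finite sets *)

Lemma sum_pow2_lt (I : finType) (P : {set I}) (f : I -> nat) (e : nat) :
  {in P &, injective f} -> (forall j, j \in P -> f j < e) ->
  \sum_(j in P) 2 ^ f j < 2 ^ e.
Proof.
elim: e P => [|e IHe] P injf ltf.
  by rewrite big1 // => j /ltf.
have IH (Q : {set I}) : Q \subset P -> (forall j, j \in Q -> f j != e) ->
    \sum_(j in Q) 2 ^ f j < 2 ^ e.
  move=> sQP neQ; have QP j := subsetP sQP j; apply: IHe => [i j iQ jQ|j jQ].
    by apply: injf; apply: QP.
  by have := ltf _ (QP _ jQ); have := neQ _ jQ; lia.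
have [/existsP[j /andP[jP /eqP fj]]|] := boolP [exists j, (j \in P) &&
  (f j == e)].
  rewrite (big_setD1 j) //= fj expnS mul2n -addnn ltn_add2l.
  apply: IH; first exact: subD1set.
  move=> i /setD1P[ij iP]; apply: contra ij => /eqP fi.
  by apply/eqP/injf => //; rewrite fi fj.
move/existsPn=> ne; have := IH P (subxx _); rewrite expnS mul2n -addnn.
move=> H; apply: leq_trans (H _) (leq_addr _ _) => j jP.
by have := ne j; rewrite jP.
Qed.

(** The greatest value over [E] stays [d] below every value over [F], so both sums compare with a
    constant sum. Used with [d = 1] for [key] and [d = 0] for [nu]. *)
Lemma sum_separated (I : finType) (E F : {set I}) (g : I -> nat) (d : nat) :
  #|E| = #|F| -> (forall e f, e \in E -> f \in F -> g e + d <= g f) ->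
  \sum_(e in E) g e + d * #|E| <= \sum_(f in F) g f.
Proof.
move=> eqEF sep; have [->|[e0 e0E]] := set_0Vmem E.
  by rewrite big_set0 cards0 muln0.
have [e eE max_e] := arg_maxnP g e0E.
apply: (@leq_trans (#|E| * (g e + d))).
  rewrite mulnDr [d * _]mulnC leq_add2r -sum_nat_const.
  exact: leq_sum.
by rewrite eqEF -sum_nat_const; apply: leq_sum => f fF; apply: sep.
Qed.

Lemma sum_setIDE (I : finType) (A B : {set I}) (g : I -> nat) :
  \sum_(a in A) g a = \sum_(a in A :&: B) g a + \sum_(a in A :\: B) g a.
Proof. exact: big_setID. Qed.

Lemma card_setD_eq (I : finType) (A B : {set I}) :
  #|A| = #|B| -> #|A :\: B| = #|B :\: A|.
Proof. by move=> eqAB; rewrite !cardsD eqAB setIC. Qed.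

(** * The order as an additive weight *)

Section Key.
Variables k n : nat.
Local Notation pt := (points k.+1 n).
Implicit Types (x y z w : pt) (A B : {set pt}) (S : {set 'I_n}).

Definition upd x (j : 'I_n) (c : 'I_k.+1) : pt :=
  [ffun i => if i == j then c else x i].

Definition supp x : {set 'I_n} := [set j | x j != 0 :> nat].

Definition wt x := #|supp x|.

(* As [j < n], codes order the pairs (c, j) lexicographically. *)
Definition code (c : nat) (j : 'I_n) := c * n + j.

(** The constant exceeds any sum of powers [2 ^ code (x j) j] over the support of a point, so [key]
    compares weights first and then binary expansions, that is, sets of pairs
    colexicographically. *)
Definition wgt (j : 'I_n) (c : nat) :=
  if c == 0 then 0 else 2 ^ (k.+1 * n) + 2 ^ code c j.

Definition key x := \sum_j wgt j (x j).

Definition clt (c : nat) (j : 'I_n) (c' : nat) (j' : 'I_n) :=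
  (c < c') || (c == c') && (j < j').

(* [t] carries the largest (value, coordinate) pair on which [x] and [y]
   differ, and this pair belongs to [y]. *)
Definition wit x y t :=
  x t < y t /\ forall j, x j != y j -> j != t ->
    clt (x j) j (y t) t /\ clt (y j) j (y t) t.

Lemma code_lt c j c' j' : (code c j < code c' j') = clt c j c' j'.
Proof.
rewrite /code /clt; have := ltn_ord j; have := ltn_ord j'.
have [lt_cc'|lt_c'c|->] := ltngtP c c' => /=; last by rewrite ltn_add2l.
  move=> *; apply: (@leq_trans (c.+1 * n)); first by rewrite mulSn; lia.
  by apply: leq_trans (leq_addr _ _); rewrite leq_mul2r lt_cc' orbT.
move=> *; apply/negbTE; rewrite -leqNgt.
apply: (@leq_trans (c'.+1 * n)); first by rewrite mulSn; lia.
by apply: leq_trans (leq_addr _ _); rewrite leq_mul2r lt_c'c orbT.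
Qed.

Lemma updE x j c i : upd x j c i = if i == j then c else x i.
Proof. by rewrite ffunE. Qed.

Lemma upd_id x j : upd x j (x j) = x.
Proof. by apply/ffunP=> i; rewrite updE; case: eqP => // ->. Qed.

Lemma upd_upd x j c d : upd (upd x j c) j d = upd x j d.
Proof. by apply/ffunP=> i; rewrite !updE; case: eqP. Qed.

Lemma key_upd x j c : key (upd x j c) + wgt j (x j) = key x + wgt j c.
Proof.
rewrite /key (bigD1 j) //= [in RHS](bigD1 j) //= updE eqxx.
rewrite (eq_bigr (fun i => wgt i (x i))) => [|i /negbTE ij]; last first.
  by rewrite updE ij.
lia.
Qed.

(** By additivity a shared coordinate contributes equally to both keys; hence one order serves
    points and slices alike. *)
Lemma key_share x y j (c : 'I_k.+1) : x j = y j ->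
  (key (upd x j c) <= key (upd y j c)) = (key x <= key y).
Proof. by move=> xy; have := key_upd x j c; have := key_upd y j c; rewrite xy;
  lia. Qed.

Lemma keyE x :
  key x = wt x * 2 ^ (k.+1 * n) + \sum_(j in supp x) 2 ^ code (x j) j.
Proof.
rewrite /wt -sum_nat_const -big_split [RHS]big_mkcond.
by apply: eq_bigr => j _; rewrite inE /wgt; case: eqP.
Qed.

Lemma code_inj x (P : {set 'I_n}) : {in P &, injective (fun j => code (x j) j)}.
Proof.
move=> i j _ _ /= eqc.
have := code_lt (x i) i (x j) j; have := code_lt (x j) j (x i) i.
by rewrite eqc ltnn /clt => H1 H2; apply/val_inj => /=; lia.
Qed.

Lemma code_max x j : code (x j) j < k.+1 * n.
Proof.
rewrite /code; have lx := ltn_ord (x j); have lj := ltn_ord j.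
apply: (@leq_trans ((x j).+1 * n)); first by rewrite mulSn; lia.
by rewrite leq_mul2r lx orbT.
Qed.

Lemma key_lt_wt x y : wt x < wt y -> key x < key y.
Proof.
move=> lt_xy; rewrite !keyE.
apply: leq_trans (leq_addr _ _); apply: (@leq_trans ((wt x).+1 * 2 ^ (k.+1 * n))).
  rewrite mulSn addnC ltn_add2r; apply: sum_pow2_lt; first exact: code_inj.
  by move=> j _; apply: code_max.
by rewrite leq_mul2r lt_xy orbT.
Qed.

(** Coordinates where [x] and [y] agree cancel. The remaining codes of [x] are distinct and below
    that of [(y t, t)], so their powers sum to less than this single power. *)
Lemma key_wit x y t : wt x = wt y -> wit x y t -> key x < key y.
Proof.
move=> eqw [ltt H]; rewrite !keyE eqw ltn_add2l.
pose Q := [set j | x j == y j].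
rewrite (big_setID Q) [X in _ < X](big_setID Q) /=.
have -> : supp x :&: Q = supp y :&: Q.
  by apply/setP=> j; rewrite !inE; case: (x j =P y j) => [->|]; rewrite ?andbF.
have -> : \sum_(j in supp y :&: Q) 2 ^ code (x j) j
        = \sum_(j in supp y :&: Q) 2 ^ code (y j) j.
  by apply: eq_bigr => j; rewrite !inE => /andP[_ /eqP->].
rewrite ltn_add2l; apply: (@leq_trans (2 ^ code (y t) t)).
  apply: sum_pow2_lt; first exact: code_inj.
  move=> j; rewrite !inE => /andP[ne _]; rewrite code_lt.
  have [->|jt] := eqVneq j t; first by rewrite /clt ltt.
  by case: (H j ne jt).
rewrite (bigD1 t) /=; first exact: leq_addr.
by rewrite !inE; apply/andP; split; [apply/eqP=> e; move: ltt; rewrite e;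
  lia | lia].
Qed.

Lemma wit_total x y : x != y -> exists t, wit x y t \/ wit y x t.
Proof.
move=> ne; have /existsP[j0 ne0] : [exists j, x j != y j].
  apply: contraNT ne => /existsPn H; apply/eqP/ffunP=> j.
  by apply/eqP; move: (H j); rewrite negbK.
pose g j := maxn (code (x j) j) (code (y j) j).
have [t net max_t] := @arg_maxnP _ j0 (fun j => x j != y j) g ne0.
have net' : (x t : nat) != y t by [].
have E c d j : j != t -> code c j <= code d t -> clt c j d t.
  move=> jt; have jt' : (j : nat) != t by [].
  by rewrite leqNgt code_lt /clt; lia.
have le_t (c d : nat) : c < d -> code c t <= code d t.
  by move=> /ltnW lt_cd; rewrite /code leq_add2r leq_mul2r lt_cd orbT.
have sep j : x j != y j -> j != t ->
    (x t < y t -> clt (x j) j (y t) t /\ clt (y j) j (y t) t) /\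
    (y t < x t -> clt (x j) j (x t) t /\ clt (y j) j (x t) t).
  move=> nej jt; have := max_t j nej; rewrite /g => le_g.
  by split=> /le_t lt_t; split; apply: E => //; lia.
exists t; case: (ltngtP (x t) (y t)) net' => // lt_t _; [left|right];
  split=> // j.
  by move=> nej jt; apply: (sep j nej jt).1.
by rewrite eq_sym => nej jt; have [_ /(_ lt_t)[]] := sep j nej jt.
Qed.

Lemma key_ltP x y : key x < key y ->
  wt x < wt y \/ wt x = wt y /\ exists t, wit x y t.
Proof.
move=> lt_xy; case: (ltngtP (wt x) (wt y)) => [|/key_lt_wt|eqw]; [by left|lia|].
right; split=> //; have [|t [|w]] := @wit_total x y; last 2 first.
- by exists t.
- by have := key_wit (esym eqw) w; lia.
by apply/eqP=> e; move: lt_xy; rewrite e; lia.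
Qed.

Lemma key_inj : injective key.
Proof.
move=> x y eqk; apply/eqP/negPn/negP => /[dup] /wit_total[t wt_t] ne.
have eqw : wt x = wt y.
  by case: (ltngtP (wt x) (wt y)) => // /key_lt_wt; rewrite eqk ltnn.
case: wt_t => w; [have := key_wit eqw w | have := key_wit (esym eqw) w];
  by rewrite eqk ltnn.
Qed.

Lemma key_lt_neq x y : (key x < key y) = (x != y) && (key x <= key y).
Proof. by rewrite ltn_neqAle (inj_eq key_inj). Qed.

Lemma card_level0 x : #|level 0 x| = n - wt x.
Proof.
have -> : level 0 x = ~: supp x by apply/setP=> j; rewrite !inE negbK.
by rewrite cardsCs setCK card_ord.
Qed.

Lemma wt_le_n x : wt x <= n.
Proof. by rewrite -[X in _ <= X]card_ord max_card. Qed.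

(** The witness [t] supplies the data of [point_le]: [y t] is the last differing level and [t] the
    greatest element of the symmetric difference there. *)
Lemma key_point_le x y : key x <= key y -> point_le x y.
Proof.
rewrite leq_eqVlt => /orP[/eqP/key_inj->|/key_ltP[lt_w|[eqw [t [ltt H]]]]].
- by constructor 1.
- by constructor 2; rewrite !card_level0; have := wt_le_n y; lia.
constructor 3; split; first by rewrite !card_level0 eqw.
have inS (c : 'I_k.+1) j : j \in symdiff (level c x) (level c y) ->
    x j != y j /\ (x j = c \/ y j = c).
  rewrite !inE => /orP[] /andP[/negbTE n1 /eqP e2]; split;
    try (by left; apply: val_inj); try (by right; apply: val_inj);
    by apply/eqP=> e; move: n1; rewrite ?e -?e ?e2 ?eqxx // e e2 eqxx.
have tS : t \in symdiff (level (y t) x) (level (y t) y).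
  by rewrite !inE eqxx andbT; apply/orP; right; rewrite neq_ltn ltt.
exists (y t); split; [split|exists t; split; [split|]] => //.
- move=> e; have : t \in level (y t) y by rewrite inE.
  by rewrite -e inE => /eqP e'; move: ltt; rewrite e' ltnn.
- move=> c nec; rewrite leqNgt; apply/negP=> lt_c; case: nec.
  apply/setP=> j; apply/eqP/negPn/negP=> ne.
  have /inS[nej ejc] : j \in symdiff (level c x) (level c y).
    by move: ne; rewrite !inE; case: (x j == c :> nat); case: (y j == c :> nat).
  have [ejt|jt] := eqVneq j t; first by rewrite ejt in ejc; case: ejc => e;
    move: lt_c ltt; rewrite e; lia.
  by have := H j nej jt; rewrite /clt; case: ejc => ->; lia.
- move=> j /inS[nej ejc]; have [->//|jt] := eqVneq j t.
  by have := H j nej jt; rewrite /clt; case: ejc => ->; lia.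
by rewrite inE.
Qed.

Lemma mem_shadow A y :
  reflect (exists x j, [/\ x \in A, x j != 0 :> nat & y = upd x j ord0])
          (y \in shadow A).
Proof.
apply: (iffP bigcupP) => [[x xA]|[x [j [xA xj ->]]]].
  rewrite inE => /existsP[j /and3P[xj /eqP yj /forallP H]]; exists x, j;
    split=> //.
  apply/ffunP=> i; rewrite updE; have [->|ij] := eqVneq i j; first exact: val_inj.
  by apply/eqP; have := H i; rewrite ij.
exists x => //; rewrite inE; apply/existsP; exists j; rewrite xj updE eqxx /=.
by apply/forallP=> i; apply/implyP=> /negbTE ij; rewrite updE ij.
Qed.

End Key.

(** * Shadows of initial segments *)

Section InitialSegments.
Variables k n : nat.
Local Notation pt := (points k.+1 n).
Local Notation one := (inord 1 : 'I_k.+1).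
Implicit Types (x y z w : pt) (A B : {set pt}) (S : {set 'I_n}).

(* All coordinate sets [S] live in the same ambient dimension [n], so that one
   [key] serves for a set of points and for its slices. *)
Definition pts S : {set pt} := [set x | supp x \subset S].

Definition initS S B :=
  B \subset pts S /\
  forall x y, x \in pts S -> y \in B -> key x <= key y -> x \in B.

Definition shadow_min S := forall A B, A \subset pts S -> initS S B ->
  #|B| = #|A| -> #|shadow B| <= #|shadow A|.

(** Setting the first zero to 1 adds the least weight among all ways to fill a zero coordinate of
    [S], so it gives the least cover of [w]. *)
Definition first_zero S w (a : 'I_n) :=
  [/\ a \in S, w a = 0 :> nat & forall l, l \in S -> l < a -> w l != 0 :> nat].

(** Coordinate [i] is reset to 0, so that slices at different values [c] can be compared as sets
    over [S :\ i]. *)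
Definition slice (i : 'I_n) (c : 'I_k.+1) A : {set pt} :=
  [set x : pt | (x i == ord0) && (upd x i c \in A)].

Lemma in_pts S x j : x \in pts S -> x j != 0 :> nat -> j \in S.
Proof. by rewrite inE => /subsetP H xj; apply: H; rewrite inE. Qed.

Lemma ptsP S x : (forall j, x j != 0 :> nat -> j \in S) -> x \in pts S.
Proof. by move=> H; rewrite inE; apply/subsetP=> j; rewrite inE; apply: H. Qed.

Lemma pts_upd S x j c : x \in pts S -> j \in S -> upd x j c \in pts S.
Proof.
move=> xS jS; apply: ptsP => l; rewrite updE; case: (l =P j) => [->//|_].
exact: in_pts.
Qed.

Lemma pts_upd0 S x j : x \in pts S -> upd x j ord0 \in pts S.
Proof.
by move=> xS; apply: ptsP => l; rewrite updE; case: (l =P j) => // _;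
  apply: in_pts.
Qed.

Lemma oneE : 0 < k -> one = 1 :> nat.
Proof. by move=> k0; rewrite inordK. Qed.

Lemma k_gt0 (c : 'I_k.+1) : c != 0 :> nat -> 0 < k.
Proof. by have := ltn_ord c; lia. Qed.

Lemma clt_le (c d e : nat) (i j : 'I_n) : c <= d -> clt d i e j -> clt c i e j.
Proof. rewrite /clt; lia. Qed.

Lemma wgt0 (j : 'I_n) : @wgt k n j 0 = 0.
Proof. by []. Qed.

Lemma wgt_lt (c d : nat) (i j : 'I_n) : 0 < c -> 0 < d ->
  (@wgt k n i c < @wgt k n j d) = clt c i d j.
Proof.
move=> c0 d0; rewrite /wgt (gtn_eqF c0) (gtn_eqF d0) ltn_add2l.
by rewrite ltn_exp2l // code_lt.
Qed.

Lemma wt_upd0 x j : x j != 0 :> nat -> (wt (upd x j ord0)).+1 = wt x.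
Proof.
move=> xj; rewrite /wt (cardsD1 j (supp x)) inE xj add1n; congr _.+1.
by apply: eq_card => l; rewrite !inE updE; case: (l =P j).
Qed.

Lemma wt_upd1 x j (c : 'I_k.+1) : x j = 0 :> nat -> c != 0 :> nat ->
  wt (upd x j c) = (wt x).+1.
Proof.
move=> xj cj; rewrite -(@wt_upd0 (upd x j c) j) ?updE ?eqxx // upd_upd.
by rewrite (_ : ord0 = x j) ?upd_id //; apply: val_inj.
Qed.

Lemma wt_upd x j (c : 'I_k.+1) : x j != 0 :> nat -> c != 0 :> nat ->
  wt (upd x j c) = wt x.
Proof.
move=> xj cj; congr #|pred_of_set _|; apply/setP=> l; rewrite !inE updE.
by case: (l =P j) => [->|//]; rewrite cj xj.
Qed.

Lemma key_wt x y : key x <= key y -> wt x <= wt y.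
Proof. by apply: contraTT; rewrite -!ltnNge; apply: key_lt_wt. Qed.

Lemma ex_first_zero S w : w \in pts S -> wt w < #|S| -> exists a,
  first_zero S w a.
Proof.
move=> wS lt_w; have [a0 a0P] : exists a, (a \in S) && (w a == 0 :> nat).
  apply/existsP; apply: contraLR lt_w; rewrite -leqNgt => /existsPn H.
  apply: subset_leq_card; apply/subsetP=> j jS; have := H j.
  by rewrite jS inE.
pose P := [pred a | (a \in S) && (w a == 0 :> nat)].
have [a /andP[aS /eqP wa] min_a] := @arg_minnP _ a0 P (fun a : 'I_n => (a :
  nat)) a0P.
exists a; split=> // l lS; rewrite ltnNge; apply: contraNN => wl.
by apply: min_a; rewrite /= lS wl.
Qed.

Lemma wt_lt_card S w j : w \in pts S -> j \in S -> w j = 0 :> nat -> wt w < #|S|.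
Proof.
rewrite inE => wS jS wj; apply: proper_card; apply/properP; split=> //.
by exists j => //; rewrite inE wj.
Qed.

Lemma key_upd0 w j (c : 'I_k.+1) : w j = 0 :> nat ->
  key (upd w j c) = key w + @wgt k n j c.
Proof. by move=> wj; have := key_upd w j c; rewrite wj wgt0 addn0. Qed.

(** Some point of [B] arises from [w] by filling a zero [j]. The first zero [a] satisfies [a <= j],
    so filling it with 1 costs no more and stays in [B]. *)
Lemma shadow_cover S B w : initS S B -> w \in shadow B ->
  exists a, first_zero S w a /\ upd w a one \in B.
Proof.
move=> [sBS initB] /mem_shadow[b [j [bB bj def_w]]].
have bS := subsetP sBS _ bB; have jS := in_pts bS bj.
have wS : w \in pts S by rewrite def_w pts_upd0.
have wj : w j = 0 :> nat by rewrite def_w updE eqxx.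
have [a fz] := ex_first_zero wS (wt_lt_card wS jS wj).
have [aS wa min_a] := fz; exists a; split=> //.
have k0 := k_gt0 bj.
apply: initB bB _; first exact: pts_upd.
have -> : b = upd w j (b j) by rewrite def_w upd_upd upd_id.
rewrite !key_upd0 // leq_add2l leqNgt wgt_lt ?oneE //; last by rewrite lt0n.
apply/negP; rewrite /clt => H; have := min_a j jS; rewrite wj.
by have: 0 < b j by [rewrite lt0n]; lia.
Qed.

(** If [a <= b], the added weights are ordered as well. If [b < a] and the weights of [x] and [y]
    agree, the top differing pair decides; only the case where it sits at [a], the position filled
    in [x], is delicate. *)
Lemma first_zero_mono S x y a b : 0 < k -> x \in pts S -> y \in pts S ->
  first_zero S x a -> first_zero S y b -> key x <= key y ->
  key (upd x a one) <= key (upd y b one).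
Proof.
move=> k0 xS yS [aS xa fa] [bS yb fb] le_xy.
have one1 := oneE k0; have n1 : one != 0 :> nat by rewrite one1.
have [le_ab|lt_ba] := leqP a b.
  rewrite !key_upd0 // leq_add // leqNgt wgt_lt one1 // /clt; lia.
have xb := fa b bS lt_ba.
have ne_xy : x != y by apply: contraNneq xb => ->; rewrite yb.
have /key_ltP[lt_w|[eqw [t [lt_t wt_t]]]] :
  key x < key y by rewrite key_lt_neq ne_xy.
  by apply/ltnW/key_lt_wt; rewrite !wt_upd1.
have tS : t \in S by apply: (in_pts yS); lia.
have bt : b != t by apply: contraTneq lt_t => <-; rewrite yb.
have ab : a != b by apply: contraTneq lt_ba => ->; rewrite ltnn.
have nxyb : x b != y b by apply: contraNneq xb => ->; rewrite yb.
have [Hb1 Hb2] := wt_t b nxyb bt.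
have eqw' : wt (upd x a one) = wt (upd y b one) by rewrite !wt_upd1 ?eqw.
have [at_|at_] := eqVneq a t; last first.
  apply/ltnW/(key_wit (t := t)) => //; split.
    by rewrite !updE ![t == _]eq_sym (negbTE at_) (negbTE bt).
  move=> j; rewrite !updE [t == b]eq_sym (negbTE bt).
  have [->|jb] := eqVneq j b; last first.
    have [->|ja] := eqVneq j a; last exact: wt_t.
    rewrite one1 => _ _; have [e|ne] := eqVneq (x a) (y a); last first.
      have [Ha1 Ha2] := wt_t a ne at_; split=> //.
      have : (x a : nat) != y a by [].
      by rewrite xa; move: Ha2; rewrite /clt; clear; lia.
    rewrite -e xa; suff: clt 1 a (y t) t by move=> H; split=> //; apply: clt_le H.
    have nat_at : (a : nat) != t by [].
    have : t < a -> 0 < x t by move=> ta; rewrite lt0n; apply: fa.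
    by move: lt_t nat_at; rewrite /clt; clear; lia.
  rewrite [b == a]eq_sym (negbTE ab) one1 => _ _; split=> //.
  by apply: clt_le Hb1; rewrite lt0n.
(* The top pair sits at [a]. If [y a = 1], all differing values are at most 1 and counting supports
   shows that the two covers coincide; if [y a > 1], coordinate [a] remains a witness. *)
subst t; have [yt|yt] : y a = 1 :> nat \/ 1 < y a by move: lt_t; clear; lia.
  apply: eq_leq; congr key; apply/ffunP=> j; rewrite !updE.
  have sub : b |: supp y :\ a \subset supp x.
    apply/subsetP=> l; rewrite !inE => /predU1P[->//|/andP[la yl]].
    have [e|ne] := eqVneq (x l) (y l); first by rewrite e.
    apply: fa; first exact: in_pts yl.
    by have [_] := wt_t l ne la; rewrite /clt yt; move: yl; clear; lia.
  have /eqP esup : b |: supp y :\ a == supp x.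
    rewrite eqEcard sub cardsU1 !inE yb eqxx andbF /=.
    by move: eqw; rewrite /wt => ->; rewrite (cardsD1 a (supp y)) inE yt.
  have [->|ja] := eqVneq j a.
    by rewrite (negbTE ab); apply: val_inj; rewrite /= one1 yt.
  have [->|jb] := eqVneq j b.
    by apply: val_inj; rewrite /= one1; move: Hb1 xb; rewrite /clt yt; clear; lia.
  have [->//|ne] := eqVneq (x j) (y j).
  have [Hx Hy] := wt_t j ne ja; have : j \in supp x = (j \in supp y).
    by rewrite -esup !inE ja (negbTE jb).
  have le1 (z : pt) : clt (z j) j (y a) a -> z j <= 1.
    by rewrite /clt yt; clear; lia.
  have := le1 y Hy; have := le1 x Hx; rewrite !inE => lx ly eq0; apply: val_inj.
  by move: lx ly eq0 => /=; case: (val (x j)) (val (y j)) => [|[|?]] [|[|?]].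
apply/ltnW/(key_wit (t := a)) => //; split.
  by rewrite !updE (negbTE ab) eqxx one1.
move=> j; rewrite !updE (negbTE ab) => + ja; rewrite (negbTE ja).
have [->|jb] := eqVneq j b => ne; last exact: wt_t.
by split=> //; rewrite one1 /clt yt.
Qed.

(** Least covers are monotone, so below a shadow point [y] the least cover of [x] lies below that of
    [y], which belongs to [B]. *)
Lemma shadow_initS S B : initS S B -> initS S (shadow B).
Proof.
move=> initB; have [sBS downB] := initB; split.
  apply/subsetP=> w /mem_shadow[x [j [xB _ ->]]].
  by apply: pts_upd0; apply: subsetP xB.
move=> x y xS yB le_xy; have [b [fb ybB]] := shadow_cover initB yB.
have yS : y \in pts S.
  by case/mem_shadow: yB => z [j [zB _ ->]]; apply/pts_upd0/(subsetP sBS).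
have k0 : 0 < k.
  by case/mem_shadow: yB => z [j [_ zj _]]; apply: k_gt0 zj.
have [bS yb _] := fb.
have [a fa] := ex_first_zero xS (leq_ltn_trans (key_wt le_xy) (wt_lt_card yS bS
  yb)).
have [aS xa _] := fa.
apply/mem_shadow; exists (upd x a one), a; rewrite updE eqxx oneE // upd_upd;
  split=> //.
  by apply: downB ybB _; [apply: pts_upd|apply: first_zero_mono fa fb _].
by rewrite (_ : ord0 = x a) ?upd_id //; apply: val_inj.
Qed.

End InitialSegments.

(** * Compression *)

Section Compression.
Variables k n : nat.
Local Notation pt := (points k.+1 n).
Local Notation one := (inord 1 : 'I_k.+1).
Implicit Types (x y z w : pt) (A B : {set pt}) (S : {set 'I_n}).

(** For [A] within [pts k S], every slice along a coordinate of [S] is an initial segment;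
    [key_share] allows the phrasing without slices. *)
Definition compressed S A := forall x y i, x \in pts k S -> y \in A -> i \in S ->
  x i = y i -> key x <= key y -> x \in A.

Lemma initS_sub S B C : initS S B -> initS S C -> #|B| <= #|C| -> B \subset C.
Proof.
move=> [sB downB] [sC downC] leBC; apply/subsetP=> x xB; apply: contraLR leBC.
move=> xC; rewrite -ltnNge; apply: proper_card; apply/properP.
split; last by exists x.
apply/subsetP=> c cC; apply: (downB _ _ (subsetP sC _ cC) xB).
rewrite leqNgt; apply: contra xC => lt_xc.
exact: downC (subsetP sB _ xB) cC (ltnW lt_xc).
Qed.

Lemma ex_initS S m : m <= #|pts k S| -> exists B, initS S B /\ #|B| = m.
Proof.
elim: m => [|m IHm] le_m.
  by exists set0; rewrite cards0; split=> //; split;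
    [apply: sub0set|move=> x y _; rewrite inE].
have [B [[sB downB] cB]] := IHm (ltnW le_m).
have [x0 x0P] : exists x, x \in pts k S :\: B.
  by apply/set0Pn; rewrite -card_gt0 cardsD (setIidPr sB) cB subn_gt0.
have [x /setDP[xS xB] min_x] := @arg_minnP _ x0 (mem (pts k S :\:
  B)) (@key k n) x0P.
exists (x |: B); split; last by rewrite cardsU1 xB cB.
split=> [|y z yS]; first by rewrite subUset sub1set xS.
rewrite !inE => /predU1P[->|zB] le_yz; last by rewrite (downB y z) ?orbT.
have [yB|yB] := boolP (y \in B); first by rewrite orbT.
have le_xy := min_x y; rewrite !inE yB /= in le_xy.
rewrite inE in yS; have {}le_xy := le_xy yS.
by rewrite orbF; apply/eqP/key_inj/eqP; rewrite eqn_leq le_yz.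
Qed.

(** Keys on [B :\: A] are smaller by at least 1 than those on [A :\: B], so a gap remains unless
    [B :\: A] is empty. The equality case serves to recognise sets fixed by compression. *)
Lemma initS_sum_key S B A : A \subset pts k S -> initS S B -> #|B| = #|A| ->
  \sum_(x in B) key x <= \sum_(x in A) key x ?= iff (B == A).
Proof.
move=> sA [sB downB] eqBA; have eqD := card_setD_eq eqBA.
have sep e f : e \in B :\: A -> f \in A :\: B -> key e + 1 <= key f.
  move=> /setDP[eB eA] /setDP[fA fB]; rewrite addn1 ltnNge.
  by apply: contra fB => le_fe; apply: downB eB le_fe; apply: subsetP fA.
have := sum_separated eqD sep;
  rewrite mul1n (sum_setIDE B A) (sum_setIDE A B) setIC.
move=> H; split; first by rewrite leq_add2l; apply: leq_trans (leq_addr _ _) H.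
apply/eqP/eqP => [|->]; last by rewrite setIid setDv.
move=> /addnI eqs; move: H;
  rewrite eqs -[X in _ <= X]addn0 leq_add2l leqn0 cards_eq0.
by rewrite setD_eq0 => sBA; apply/eqP; rewrite eqEcard sBA eqBA /=.
Qed.

Lemma sum_slice i A (G : pt -> nat) :
  \sum_(a in A) G a = \sum_c \sum_(x in slice i c A) G (upd x i c).
Proof.
rewrite (partition_big (fun a : pt => a i) predT) //=; apply: eq_bigr => c _.
rewrite (reindex_onto (fun x => upd x i c) (fun a => upd a i ord0)) /=;
  last first.
  by move=> a /andP[_ /eqP<-]; rewrite upd_upd upd_id.
apply: eq_bigl => x; rewrite inE updE eqxx eqxx andbT upd_upd andbC;
  congr (_ && _).
apply/eqP/eqP => [<-|<-]; first by rewrite updE eqxx.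
exact: upd_id.
Qed.

Lemma card_slice i A : #|A| = \sum_c #|slice i c A|.
Proof.
by rewrite -sum1_card (sum_slice i); apply: eq_bigr => c _; rewrite sum1_card.
Qed.

Lemma slice_inj i A B : (forall c, slice i c A = slice i c B) -> A = B.
Proof.
move=> H; apply/setP=> a; have /setP/(_ (upd a i ord0)) := H (a i).
by rewrite !inE updE !eqxx !upd_upd upd_id.
Qed.

Lemma slice_pts S i c A : A \subset pts k S -> slice i c A \subset pts k (S :\ i).
Proof.
move=> /subsetP sA; apply/subsetP=> x; rewrite inE => /andP[/eqP xi /sA xS].
apply: ptsP => j xj; have ji : j != i by apply: contraNneq xj => ->; rewrite xi.
by rewrite !inE ji; apply: (in_pts xS); rewrite updE (negbTE ji).
Qed.

Lemma upd_comm x i j (c d : 'I_k.+1) : i != j ->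
  upd (upd x i c) j d = upd (upd x j d) i c.
Proof.
move=> ij; apply/ffunP=> l; rewrite !updE.
by have [->|//] := eqVneq l j; rewrite eq_sym (negbTE ij).
Qed.

Lemma slice_shadow i (c : 'I_k.+1) A : c != ord0 ->
  slice i c (shadow A) = shadow (slice i c A).
Proof.
move=> c0; apply/setP=> x; rewrite inE; apply/andP/mem_shadow.
  move=> [/eqP xi /mem_shadow[a [j [aA aj e]]]].
  have ij : i != j.
    apply: contraNneq c0 => ij; move/ffunP/(_ i): e.
    by rewrite !updE ij !eqxx => ->.
  exists (upd a i ord0), j; split.
  - rewrite inE updE eqxx eqxx upd_upd.
    suff -> : c = a i by rewrite upd_id.
    by move/ffunP/(_ i): e; rewrite !updE eqxx (negbTE ij).
  - by rewrite updE [j == i]eq_sym (negbTE ij).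
  by rewrite upd_comm // -e upd_upd -xi upd_id.
move=> [y [j [/[!inE] /andP[/eqP yi yA] yj ->]]].
have ij : i != j by apply: contraNneq yj => <-; rewrite yi.
rewrite updE (negbTE ij) yi; split=> //; apply/mem_shadow.
exists (upd y i c), j; rewrite yA updE [j == i]eq_sym (negbTE ij); split=> //.
by rewrite upd_comm // eq_sym.
Qed.

(** Either another coordinate is zeroed, or coordinate [i] itself, and then the slices at non-zero
    values appear unchanged. *)
Lemma slice0_shadow i A : slice i ord0 (shadow A) =
  shadow (slice i ord0 A) :|: \bigcup_(c : 'I_k.+1 | c != ord0) slice i c A.
Proof.
apply/setP=> x; rewrite !inE; apply/andP/orP.
  move=> [/eqP xi]; rewrite (_ : upd x i ord0 = x); last by rewrite -xi upd_id.
  move=> /mem_shadow[a [j [aA aj e]]].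
  have [eji|ij] := eqVneq i j; [right|left].
    apply/bigcupP; exists (a i); first by apply: contraNneq aj => e0;
      rewrite -eji e0.
    by rewrite inE xi eqxx e eji upd_upd upd_id.
  apply/mem_shadow; exists a, j; split=> //; rewrite inE.
  have -> : a i = ord0 by rewrite -xi e updE (negbTE ij).
  by rewrite eqxx (_ : upd a i ord0 = a) //; rewrite -[RHS](upd_id a i);
     congr (upd _ _ _); rewrite -xi e updE (negbTE ij).
move=> [/mem_shadow[y [j [/[!inE] /andP[/eqP yi yA] yj ->]]]|/bigcupP[c c0]].
  have ij : i != j by apply: contraNneq yj => <-; rewrite yi.
  rewrite updE (negbTE ij) yi; split=> //; apply/mem_shadow.
  exists (upd y i ord0), j; rewrite yA updE [j == i]eq_sym (negbTE ij);
    split=> //.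
  by rewrite upd_comm // eq_sym.
rewrite inE => /andP[xi xA]; split=> //; apply/mem_shadow.
by exists (upd x i c), i; rewrite xA updE eqxx upd_upd; split.
Qed.

(** Each slice becomes the initial segment of its size. Slices of the shadow at non-zero values do
    not grow, by hypothesis; the slice at 0 is a union of initial segments, hence nested, and all
    fit into one segment [C] as large as the old slice. *)
Lemma compress S i A : shadow_min k (S :\ i) -> i \in S -> A \subset pts k S ->
  exists A', [/\ A' \subset pts k S, #|A'| = #|A|, #|shadow A'| <= #|shadow A|,
    \sum_(x in A') key x <= \sum_(x in A) key x ?= iff (A' == A) &
    forall c, initS (S :\ i) (slice i c A')].
Proof.
move=> IH iS sA; have /fin_all_exists[f fP] : forall c : 'I_k.+1,
    exists B, initS (S :\ i) B /\ #|B| = #|slice i c A|.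
  by move=> c; apply/ex_initS/subset_leq_card/slice_pts.
pose A' := [set x : pt | upd x i ord0 \in f (x i)].
have sliceA' c : slice i c A' = f c.
  apply/setP=> x; rewrite !inE upd_upd updE eqxx; apply/andP/idP.
    by case=> /eqP xi; rewrite -{1}xi upd_id.
  move=> xf; have xS := subsetP (fP c).1.1 _ xf.
  have xi : x i = ord0.
    by apply/val_inj/eqP; apply/negPn/negP => /(in_pts xS); rewrite !inE eqxx.
  by rewrite xi; split=> //; rewrite -xi upd_id.
have sumA' : \sum_(x in A') key x <= \sum_(x in A) key x ?= iff (A' == A).
  have H c : true -> \sum_(x in slice i c A') key (upd x i c) <=
      \sum_(x in slice i c A) key (upd x i c) ?= iff (slice i c A' == slice i c
        A).
    have E B : \sum_(x in slice i c B) key (upd x i c) =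
        \sum_(x in slice i c B) key x + #|slice i c B| * @wgt k n i c.
      rewrite -sum_nat_const -big_split; apply: eq_bigr => x;
        rewrite inE => /andP[/eqP xi _].
      by rewrite key_upd0 // xi.
    have [initf cf] := fP c; have := initS_sum_key (slice_pts i c sA) initf cf.
    rewrite !E -sliceA' in cf * => -[le_s eq_s]; split; rewrite cf.
      by rewrite leq_add2r.
    by rewrite eqn_add2r.
  rewrite !(sum_slice i); have [le_s eq_s] := leqif_sum H; split=> //;
    rewrite eq_s.
  apply/forall_inP/eqP => [eq_sec|-> //]; apply: (@slice_inj i) => c.
  exact/eqP/eq_sec.
exists A'; split=> //; last by move=> c; rewrite sliceA'; case: (fP c).
- apply/subsetP=> x; rewrite inE => /(subsetP (fP _).1.1) xS.
  apply: ptsP => j xj; have [->//|ji] := eqVneq j i.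
  by have := @in_pts _ _ _ _ j xS; rewrite updE (negbTE ji) !inE ji => /(_ xj).
- by rewrite !(card_slice i); apply: eq_bigr => c _; rewrite sliceA' (fP c).2.
rewrite !(card_slice i); apply: leq_sum => c _.
have sm B : initS (S :\ i) B -> #|B| = #|slice i c A| ->
  #|shadow B| <= #|shadow (slice i c A)|.
  exact: IH (slice_pts _ _ sA).
have [->|c0] := eqVneq c ord0; last first.
  by rewrite !slice_shadow // sliceA'; apply: sm; case: (fP c).
have ssA : shadow A \subset pts k S.
  by apply/subsetP=> w /mem_shadow[x [j [xA _ ->]]]; apply/pts_upd0/(subsetP sA).
have [C [initC cC]] := @ex_initS (S :\ i) #|slice i ord0 (shadow A)|
  (subset_leq_card (slice_pts i ord0 ssA)).
rewrite -cC; apply: subset_leq_card; rewrite slice0_shadow sliceA' subUset.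
apply/andP; split.
  apply: initS_sub (shadow_initS (fP _).1) initC _; rewrite cC slice0_shadow.
  apply: leq_trans (subset_leq_card (subsetUl _ _)).
  by apply: IH (slice_pts _ _ sA) (fP _).1 (fP _).2.
apply/bigcupsP=> d d0; rewrite sliceA'; apply: initS_sub (fP _).1 initC _.
rewrite cC (fP d).2 slice0_shadow; apply: subset_leq_card.
by apply: subset_trans (subsetUr _ _); apply: (bigcup_sup d).
Qed.

(** Among the sets no worse than [A], one of least total key is fixed by every compression, by the
    equality case of [compress]. *)
Lemma ex_compressed S A : (forall i, i \in S -> shadow_min k (S :\ i)) ->
  A \subset pts k S ->
  exists A', [/\ A' \subset pts k S, #|A'| = #|A|, #|shadow A'| <= #|shadow A| &
                 compressed S A'].
Proof.
move=> IH sA.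
pose P := [pred A' : {set pt} | [&& A' \subset pts k S, #|A'| == #|A| &
                                    #|shadow A'| <= #|shadow A|]].
have PA : P A by rewrite /= sA eqxx leqnn.
have [A' /and3P[sA' /eqP cA' shA'] min_A'] :=
  arg_minnP (fun A' : {set pt} => \sum_(x in A') key x) PA.
exists A'; split=> // x y i xS yA iS xyi le_xy.
have [A'' [sA'' cA'' shA'' le_s initA'']] := compress (IH i iS) iS sA'.
have eqA : A'' = A'.
  apply/eqP; rewrite -le_s.2 eqn_leq le_s.1 min_A' //= sA'' cA'' cA' eqxx.
  exact: leq_trans shA'' shA'.
subst A''; have [_ down] := initA'' (x i).
have /(down _ (upd y i ord0)) H : upd x i ord0 \in pts k (S :\ i).
  apply: ptsP => j; rewrite updE !inE; case: (j =P i) => // _ /=.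
  exact: in_pts.
have := H _ _; rewrite !inE !updE !eqxx !upd_upd upd_id /=; apply.
  by rewrite xyi upd_id.
by rewrite key_share.
Qed.

End Compression.

(** * Unlinked pairs *)

Section Unlinked.
Variables k n : nat.
Local Notation pt := (points k.+1 n).
Local Notation one := (inord 1 : 'I_k.+1).
Implicit Types (x y z w : pt) (A B : {set pt}) (S : {set 'I_n}).

(* [x] is the least cover of the point obtained by changing [x j] to 0. *)
Definition fresh S x (j : 'I_n) :=
  [&& j \in S, x j == 1 :> nat &
      [forall l in S, (l < j) ==> (x l != 0 :> nat)]].

Definition nu S x := #|[set j | fresh S x j]|.

(** In a compressed set containing [y], such a [z] would belong through [y], and then [x] through
    [z]. So a missing [x] below a present [y] admits no such [z]. *)
Definition unlinked S x y := forall z, z \in pts k S -> key x <= key z ->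
  key z <= key y -> (exists2 j, j \in S & z j = x j) ->
  (exists2 j, j \in S & z j = y j) -> False.

(* The only shape of unlinked pairs [x], [y] with [key x < key y] and
   [nu S y < nu S x]: see [unlinked_nu]. *)
Definition inverted S x y (p : 'I_n) :=
  [/\ p \in S, x p = 1 :> nat, 1 < y p, forall q, q \in S -> x q != 0 :> nat &
      forall q, q \in S -> q != p ->
        [/\ 1 < y q, y q < x q & clt (x q) q (y p) p]].

Lemma lt_ord_neq (i j : 'I_n) : i < j -> i != j.
Proof. by move=> ij; rewrite -val_eqE neq_ltn ij. Qed.

Lemma freshP S x j : reflect [/\ j \in S, x j = 1 :> nat &
    forall l, l \in S -> l < j -> x l != 0 :> nat] (fresh S x j).
Proof.
apply: (iffP and3P) => [[jS /eqP xj H]|[jS xj H]].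
  by split=> // l lS; apply/implyP; move/forall_inP: H; apply.
by split=> //; [rewrite xj | apply/forall_inP=> l lS; apply/implyP/H].
Qed.

(** The zeroed coordinate is recovered as the first zero in [S] of the result, and its former value
    is 1. *)
Lemma fresh_inj S a b i j : fresh S a i -> fresh S b j ->
  upd a i ord0 = upd b j ord0 -> (a, i) = (b, j).
Proof.
move=> /freshP[iS ai fi] /freshP[jS bj fj] e.
have eij : i = j.
  have zi := congr1 (fun f : pt => f i : nat) e;
    have zj := congr1 (fun f : pt => f j : nat) e.
  move: zi zj; rewrite /= !updE !eqxx => zi zj; apply: val_inj => /=.
  case: (ltngtP i j) => // lt_ij.
    have := fj i iS lt_ij; move: zi; rewrite (_ : (i == j) = false) => [<-//|].
    exact/negbTE/lt_ord_neq.
  have := fi j jS lt_ij; move: zj; rewrite (_ : (j == i) = false) => [->//|].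
  by apply/negbTE; rewrite -val_eqE /= ltn_eqF.
subst j; congr (_, _); rewrite -(upd_id a i) -(upd_id b i).
have -> : a i = b i by apply: val_inj; rewrite /= ai bj.
by rewrite -(upd_upd a i ord0) e upd_upd.
Qed.

Definition fresh_pairs S A := [set u : pt * 'I_n | (u.1 \in A) &&
  fresh S u.1 u.2].

Lemma sum_nuE S A : \sum_(a in A) nu S a = #|fresh_pairs S A|.
Proof.
rewrite -sum1_card; under eq_bigr do rewrite /nu -sum1_card.
rewrite pair_big_dep /=; apply: eq_bigl => u; by rewrite !inE.
Qed.

Lemma card_fresh_pairs S A :
  #|[set upd u.1 u.2 ord0 | u in fresh_pairs S A]| = #|fresh_pairs S A|.
Proof.
rewrite card_in_imset // => -[a i] [b j];
  rewrite !inE /= => /andP[_ ai] /andP[_ bj].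
exact: (fresh_inj ai bj).
Qed.

(** Distinct fresh pairs of [A] give distinct shadow points. *)
Lemma sum_nu_le S A : \sum_(a in A) nu S a <= #|shadow A|.
Proof.
rewrite sum_nuE -card_fresh_pairs; apply: subset_leq_card; apply/subsetP=> w.
case/imsetP=> -[a j]; rewrite inE /= => /andP[aA /freshP[_ aj _]] ->.
by apply/mem_shadow; exists a, j; rewrite aj.
Qed.

(** Every shadow point has its least cover in [B], hence comes from a fresh pair. *)
Lemma sum_nu_initS S B : initS S B -> #|shadow B| <= \sum_(b in B) nu S b.
Proof.
move=> initB; rewrite sum_nuE -card_fresh_pairs; apply: subset_leq_card.
apply/subsetP=> w wB; have [a [[aS wa fa] uB]] := shadow_cover initB wB.
apply/imsetP; exists (upd w a one, a); last first.
  by rewrite /= upd_upd (_ : ord0 = w a) ?upd_id //; apply: val_inj.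
have k0 : 0 < k by case/mem_shadow: wB => x [j [_ xj _]]; apply: k_gt0 xj.
rewrite inE /= uB; apply/freshP; split=> //; first by rewrite updE eqxx oneE.
move=> l lS la; rewrite /= updE; case: (l =P a) => [_|_]; first by rewrite oneE.
exact: fa.
Qed.

Lemma compressed_unlinked S A x y : compressed S A -> x \in pts k S ->
  x \notin A -> y \in A -> unlinked S x y.
Proof.
move=> cA xS xA yA z zS le_xz le_zy [j jS zx] [i iS zy]; move/negP: xA; apply.
apply: (cA x z j) => //; exact: (cA z y i).
Qed.

Lemma unlinked_neq S x y j : unlinked S x y -> x \in pts k S ->
  key x <= key y -> j \in S -> x j != y j.
Proof.
move=> U xS le_xy jS; apply/eqP=> e.
by apply: (U x) => //; [exists j | exists j].
Qed.

Lemma key_swap y i j (c : 'I_k.+1) : y j = 0 :> nat -> i != j ->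
  key (upd (upd y j c) i ord0) + @wgt k n i (y i) = key y + @wgt k n j c.
Proof.
move=> yj ij; rewrite -(key_upd0 c yj).
by have := key_upd (upd y j c) i ord0; rewrite updE (negbTE ij) => ->;
  apply: addn0.
Qed.

Lemma wt_swap y i j (c : 'I_k.+1) : y j = 0 :> nat -> y i != 0 :> nat ->
  c != 0 :> nat -> wt (upd (upd y j c) i ord0) = wt y.
Proof.
move=> yj yi cj; have ij : i != j by apply: contraNneq yi => ->; rewrite yj.
by apply: succn_inj; rewrite wt_upd0 ?wt_upd1 // updE (negbTE ij).
Qed.

Lemma key_lower y j (c : 'I_k.+1) : 0 < c -> c < y j -> key (upd y j c) < key y.
Proof.
move=> c0 lt_c; have := key_upd y j c;
  have := @wgt_lt k n c (y j) j j c0 (ltn_trans c0 lt_c).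
rewrite /clt lt_c /=; lia.
Qed.

Lemma key_swap_lt y i j (c : 'I_k.+1) : y j = 0 :> nat -> y i != 0 :> nat ->
  0 < c -> clt c j (y i) i -> key (upd (upd y j c) i ord0) < key y.
Proof.
move=> yj yi c0 lt_c; have ij : i != j by apply: contraNneq yi => ->; rewrite yj.
have := key_swap c yj ij; have := @wgt_lt k n c (y i) j i c0;
  rewrite lt0n yi lt_c.
by move=> /(_ isT); lia.
Qed.

Lemma ex_supp_diff x y i : wt x <= wt y -> x i != 0 :> nat -> y i = 0 :> nat ->
  exists2 l, x l = 0 :> nat & y l != 0 :> nat.
Proof.
move=> le_w xi yi; have : ~~ (supp y \subset supp x).
  apply: contraL le_w => sub; rewrite -ltnNge; apply: proper_card; apply/properP.
  by split=> //; exists i; rewrite inE ?yi.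
case/subsetPn=> l; rewrite !inE negbK => yl /eqP xl; by exists l.
Qed.

Lemma ex_other_supp y j : 1 < wt y -> exists2 s, s != j & y s != 0 :> nat.
Proof.
move=> wy; have : ~~ (supp y \subset [set j]).
  by apply: contraL wy => /subset_leq_card; rewrite cards1 -leqNgt.
by case/subsetPn=> s; rewrite !inE => ys sj; exists s.
Qed.

(** A fresh [j] would allow a [z] of the weight of [y] to be built from [y] with value 1 at [j]: it
    lies between [x] and [y], sharing [j] with [x] and another coordinate with [y]. *)
Lemma unlinked_lighter_fresh S x y j : x \in pts k S -> y \in pts k S ->
  unlinked S x y -> wt x < wt y -> ~~ fresh S x j.
Proof.
move=> xS yS U lt_w; apply/negP=> /freshP[jS xj fj].
have k0 : 0 < k by apply: (@k_gt0 k (x j)); rewrite xj.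
have one1 := oneE k0; have exj : one = x j by apply: val_inj; rewrite /= one1 xj.
have neq := unlinked_neq U xS (ltnW (key_lt_wt lt_w)).
have yj1 : y j != 1 :> nat by apply: contra (neq j jS) => /eqP e;
  apply/eqP/val_inj; rewrite /= xj e.
have wx : 0 < wt x by apply/card_gt0P; exists j; rewrite inE xj.
have [yj0|yj0] := eqVneq (y j : nat) 0; last first.
  have [s sj ys] := ex_other_supp j (leq_ltn_trans wx lt_w).
  have wz : wt (upd y j one) = wt y by rewrite wt_upd // one1.
  apply: (U (upd y j one)).
  - exact: pts_upd.
  - by apply/ltnW/key_lt_wt; rewrite wz.
  - by apply/ltnW/key_lower; rewrite one1 //; clear -yj0 yj1; lia.
  - by exists j => //; rewrite updE eqxx.
  by exists s; [apply: in_pts ys | rewrite updE (negbTE sj)].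
(* With [y j = 0], a value is moved to [j] from a coordinate [i] where [x] vanishes; [i] comes after
   [j] because [x] has no zero in [S] before a fresh coordinate. *)
have [i xi yi] : exists2 i, x i = 0 :> nat & y i != 0 :> nat.
  by apply: (ex_supp_diff (ltnW lt_w) _ yj0); rewrite xj.
have iS := in_pts yS yi.
have ij : i != j by apply: contraNneq yi => ->; rewrite yj0.
have lt_ji : j < i.
  rewrite ltn_neqAle eq_sym ij leqNgt; apply: contraTN isT => /(fj i iS).
  by rewrite xi.
have [s si ys] := ex_other_supp i (leq_ltn_trans wx lt_w).
have sj : s != j by apply: contraNneq ys => ->; rewrite yj0.
have wz : wt (upd (upd y j one) i ord0) = wt y by rewrite wt_swap // one1.
apply: (U (upd (upd y j one) i ord0)).
- by apply/pts_upd0/pts_upd.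
- by apply/ltnW/key_lt_wt; rewrite wz.
- apply/ltnW/key_swap_lt; rewrite ?one1 // /clt lt_ji andbT.
  by move: yi; clear; lia.
- by exists j => //; rewrite !updE eqxx eq_sym (negbTE ij).
by exists s; [apply: in_pts ys | rewrite !updE (negbTE si) (negbTE sj)].
Qed.

(** * Unlinked pairs of equal weight with top differing coordinate [p] *)

Section SameWeight.
Variables (S : {set 'I_n}) (x y : pt) (p : 'I_n).
Hypotheses (xS : x \in pts k S) (yS : y \in pts k S) (U : unlinked S x y).
Hypotheses (eq_wt : wt x = wt y) (wit_p : wit x y p).

Let le_xy : key x <= key y := ltnW (key_wit eq_wt wit_p).
Let neq j : j \in S -> x j != y j := @unlinked_neq S x y j U xS le_xy.
Let yp : y p != 0 :> nat. Proof. by have [lt_p _] := wit_p; rewrite -lt0n;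
  lia. Qed.
Let pS : p \in S := in_pts yS yp.

(** All coordinates of [S] differ in [x] and [y], so off [p] both have pairs below [(y p, p)], and
    so does [z]. Thus [p] witnesses that [z] is above [x], and [z] would link [x] with [y]. *)
Lemma unlinked_top z : z \in pts k S -> wt z = wt y -> z p = y p ->
  key z <= key y -> (forall j, z j <= x j \/ z j <= y j) ->
  (exists2 j, j \in S & z j = x j) -> False.
Proof.
move=> zS wz zp le_zy le_z zx; have [lt_p wp] := wit_p.
apply: (U zS _ le_zy zx); last by exists p.
apply/ltnW/(key_wit (t := p)); first by rewrite wz.
split; first by rewrite zp.
move=> j ne_xz jp; rewrite zp.
have jS : j \in S.
  apply: contraNT ne_xz => jS; apply/eqP/val_inj => /=.
  have z0 w : w \in pts k S -> w j = 0 :> nat.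
    by move=> wS; apply/eqP; apply: contraNT jS; apply: in_pts.
  by rewrite !z0.
have [Hx Hy] := wp j (neq jS) jp; split=> //.
by case: (le_z j) => /clt_le; apply.
Qed.

Hypothesis wt_gt1 : 1 < wt x.

(** Such a [j] determines the supports: [x] is non-zero exactly on the coordinates of [S] up to [j],
    and [y] exactly on [p] and those before [j], with value 1 at the latter. *)
Lemma fresh_not_top j : fresh S x j -> j != p -> nu S x <= 1 <= nu S y.
Proof.
move=> newj jp; have /freshP[jS xj fj] := newj.
have k0 : 0 < k by apply: (@k_gt0 k (x j)); rewrite xj.
have one1 := oneE k0; have exj : one = x j by apply: val_inj; rewrite /= one1 xj.
have pj : p != j by rewrite eq_sym.
have y_le l : l \in S -> x l = 1 :> nat -> y l != 1 :> nat.
  by move=> lS xl; apply: contra (neq lS) => /eqP e; apply/eqP/val_inj;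
    rewrite /= xl e.
(* A non-zero [y j] could be lowered to 1, giving a linking point. *)
have yj0 : y j = 0 :> nat.
  apply/eqP/negPn/negP => yj; have yj1 := y_le j jS xj.
  apply: (@unlinked_top (upd y j one)).
  - exact: pts_upd.
  - by rewrite wt_upd // one1.
  - by rewrite updE (negbTE pj).
  - by apply/ltnW/key_lower; rewrite one1 //; clear -yj yj1; lia.
  - move=> l; rewrite updE; case: (l =P j) => [->|_]; [left|right] => //.
    by rewrite one1 xj.
  by exists j => //; rewrite updE eqxx.
(* Otherwise replacing the value at [l] by a 1 at [j] would lower the key and give a linking
   point. *)
have C l : l != p -> y l != 0 :> nat -> l < j /\ y l = 1 :> nat.
  move=> lp yl; have lj : l != j by apply: contraNneq yl => ->; rewrite yj0.
  suff : ~~ clt 1 j (y l) l.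
    have : (l : nat) != j by []. move: yl; rewrite /clt; clear; lia.
  apply/negP=> lt_jl; apply: (@unlinked_top (upd (upd y j one) l ord0)).
  - by apply/pts_upd0/pts_upd.
  - by rewrite wt_swap // one1.
  - by rewrite !updE (negbTE pj) eq_sym (negbTE lp).
  - by apply/ltnW/key_swap_lt; rewrite ?one1.
  - move=> q; rewrite !updE; case: (q =P l) => [_|_]; first by left.
    by case: (q =P j) => [->|_]; [left|right]; rewrite ?one1 ?xj.
  by exists j => //; rewrite !updE eqxx eq_sym (negbTE lj).
(* Since the weights agree, the inclusions of [J] in [supp x] and of [supp y] in [p |: (J :\ j)]
   become equalities. *)
pose J := [set l in S | l <= j].
have sJx : J \subset supp x.
  apply/subsetP=> l; rewrite !inE => /andP[lS];
    rewrite leq_eqVlt => /orP[/eqP/val_inj->|].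
    by rewrite xj.
  exact: fj.
have jJ : j \in J by rewrite inE jS leqnn.
have sy : supp y \subset p |: (J :\ j).
  apply/subsetP=> l; rewrite !inE => yl; have [//|lp] := eqVneq l p.
  have [lt_l yl1] := C l lp yl; rewrite /= (ltnW lt_l) (in_pts yS yl) andbT.
  by rewrite lt_ord_neq.
have cJ : #|J| = (#|J :\ j|).+1 by rewrite (cardsD1 j J) jJ.
have le_U : #|p |: (J :\ j)| <= #|J| by rewrite cardsU1 cJ -add1n leq_add2r
  leq_b1.
have le_y : wt y <= #|p |: (J :\ j)| := subset_leq_card sy.
have le_J : #|J| <= wt x := subset_leq_card sJx.
have /eqP esy : supp y == p |: (J :\ j).
  by rewrite eqEcard sy (leq_trans le_U) // (leq_trans le_J) // eq_wt.
have /eqP esx : J == supp x.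
  by rewrite eqEcard sJx -[#|_|]/(wt x) eq_wt (leq_trans le_y).
have y1 l : l \in S -> l < j -> y l != 0 :> nat.
  move=> lS lj; have : l \in supp y.
    by rewrite esy !inE lS (ltnW lj) lt_ord_neq ?orbT.
  by rewrite inE.
have pNJ : p \notin J :\ j.
  apply/negP=> pJ; move: le_y; rewrite cardsU1 pJ add0n -ltnS -cJ ltnNge -eq_wt.
  by rewrite le_J.
have y1' l : l \in S -> l < j -> y l = 1 :> nat.
  move=> lS lj; have [|//] := C l _ (y1 l lS lj).
  apply: contraNneq pNJ => <-.
  by rewrite !inE lS (ltnW lj) lt_ord_neq.
(* Another fresh coordinate of [x] would precede [j], where [y] is 1 too, although [x] and [y] agree
   nowhere on [S]. As [wt x > 1], some coordinate of [S] does precede [j], and it is fresh in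
   [y]. *)
apply/andP; split.
  rewrite -(cards1 j); apply: subset_leq_card; apply/subsetP=> l; rewrite !inE.
  move=> /freshP[lS xl _]; have : l \in J by rewrite esx inE xl.
  rewrite inE lS /= leq_eqVlt => /orP[/eqP/val_inj->//|lj].
  by have := y_le l lS xl; rewrite y1'.
have [l lj xl] := ex_other_supp j wt_gt1.
have : l \in J by rewrite esx inE.
rewrite inE => /andP[lS le_lj].
have lt_lj : l < j by rewrite ltn_neqAle le_lj andbT.
apply/card_gt0P; exists l; rewrite inE; apply/freshP; split=> //;
  first exact: y1'.
by move=> q qS ql; apply: y1 => //; apply: ltn_trans lt_lj.
Qed.

(** Changes of [y] towards [x] that keep the top pair are forbidden. This makes both points non-zero
    on all of [S], where a value 1 of [y] would be fresh. *)
Lemma fresh_top : fresh S x p -> nu S y = 0 -> inverted S x y p.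
Proof.
move=> /freshP[_ xp fp] /eqP; rewrite cards_eq0 => /eqP nuy.
have noy l : ~~ fresh S y l by have /setP/(_ l) := nuy; rewrite !inE => ->.
have k0 : 0 < k by apply: (@k_gt0 k (x p)); rewrite xp.
have one1 := oneE k0; have [lt_p wp] := wit_p.
have lower l (c : 'I_k.+1) : l != p -> 0 < c -> c < y l -> c = x l -> l \in S ->
  False.
  move=> lp c0 lt_c cx lS; apply: (@unlinked_top (upd y l c)).
  - exact: pts_upd.
  - by rewrite wt_upd // -lt0n //; apply: ltn_trans lt_c.
  - by rewrite updE eq_sym (negbTE lp).
  - exact/ltnW/key_lower.
  - by move=> q; rewrite updE; case: (q =P l) => [->|_]; [left; rewrite cx|right].
  by exists l => //; rewrite updE eqxx.
(* At a zero [q] of [x], moving [y q] as a 1 to a zero [t] of [y] creates agreement with [x] at [q].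
   Hence [y q = 1] and [q] precedes all zeros of [y], so it would be fresh in [y]. *)
have full q : q \in S -> x q != 0 :> nat.
  move=> qS; apply/negP=> /eqP xq.
  have yq : y q != 0 :> nat.
    by apply: contra (neq qS) => /eqP e; apply/eqP/val_inj; rewrite /= xq e.
  have qp : q != p by apply: contra_eq_neq xq => ->; rewrite xp.
  have H t : t \in S -> y t = 0 :> nat -> y q = 1 :> nat /\ q < t.
    move=> tS yt; have tp : t != p by apply: contraNneq yp => <-; rewrite yt.
    have qt : q != t by apply: contraNneq yq => ->; rewrite yt.
    suff : ~~ clt 1 t (y q) q.
      have : (q : nat) != t by []. move: yq; rewrite /clt; clear; lia.
    apply/negP=> lt_tq; apply: (@unlinked_top (upd (upd y t one) q ord0)).
    - by apply/pts_upd0/pts_upd.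
    - by rewrite wt_swap // one1.
    - by rewrite !updE ![p == _]eq_sym (negbTE tp) (negbTE qp).
    - by apply/ltnW/key_swap_lt; rewrite ?one1.
    - move=> l; rewrite !updE; case: (l =P q) => [_|_]; first by left.
      case: (l =P t) => [->|_]; [left|right] => //; rewrite one1 lt0n.
      by apply: contra (neq tS) => /eqP e; apply/eqP/val_inj; rewrite /= yt e.
    by exists q => //; rewrite updE eqxx; apply: val_inj; rewrite /= xq.
  have [t yt xt] := ex_supp_diff (eq_leq (esym eq_wt)) yq xq.
  have [yq1 _] := H t (in_pts xS xt) yt.
  have /negP := noy q; apply; apply/freshP; split=> // l lS lq.
  by apply/negP=> /eqP /(H l lS)[_]; rewrite ltnNge (ltnW lq).
have fully q : q \in S -> y q != 0 :> nat.
  have : S \subset supp y.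
    have sy : supp y \subset S by have := yS; rewrite inE.
    have sx : S \subset supp x by apply/subsetP=> l lS; rewrite inE full.
    have /eqP-> // : supp y == S.
    by rewrite eqEcard sy -/(wt y) -eq_wt subset_leq_card.
  by move=> /subsetP H /H; rewrite inE.
split=> //; first by rewrite -{1}xp.
move=> q qS qp; have [Hx Hy] := wp q (neq qS) qp; split=> //.
  have := noy q; have := fully q qS;
    case: (y q : nat) (freshP S y q) => [//|[|//]].
  move=> H _ /negP[]; apply/H; split=> // l lS _; exact: fully.
case: (ltngtP (y q) (x q)) => // [lt_q|/val_inj e].
  by case: (@lower q (x q)) => //; rewrite lt0n full.
by have := neq qS; rewrite e eqxx.
Qed.

End SameWeight.

(** For unequal weights [x] has no fresh coordinate. For equal weights a fresh coordinate off the
    top settles the inequality, and if only the top one is fresh then [nu S x = 1]. *)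
Lemma unlinked_nu S x y : x \in pts k S -> y \in pts k S -> unlinked S x y ->
  key x < key y -> 1 < wt y ->
  nu S x <= nu S y \/ [/\ nu S x = 1, nu S y = 0 & exists p, inverted S x y p].
Proof.
move=> xS yS U lt_xy wy.
have [nu0|] := posnP (nu S x); first by left; rewrite nu0.
move=> /card_gt0P[j]; rewrite inE => newj.
have [lt_w|[eq_w [p wit_p]]] := key_ltP lt_xy.
  by have /negP := unlinked_lighter_fresh j xS yS U lt_w.
rewrite -eq_w in wy.
have [[q newq qp]|top] : (exists2 q, fresh S x q & q != p) \/ (forall q,
  fresh S x q -> q = p).
  have [/existsP[q /andP[nq qp]]|] := boolP [exists q, fresh S x q && (q != p)].
    by left; exists q.
  move/existsPn=> H; right=> q nq; apply/eqP; have := H q.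
  by rewrite nq negbK.
  have /andP[nx ny] := fresh_not_top xS yS U eq_w wit_p wy newq qp.
  by left; apply: leq_trans ny.
have nx : nu S x = 1.
  rewrite -(cards1 p); congr #|pred_of_set _|; apply/setP=> q; rewrite !inE.
  apply/idP/eqP => [/top//|->]; by rewrite -(top j newj).
have [nuy|] := posnP (nu S y); last by left; rewrite nx.
right; split=> //; exists p; apply: fresh_top => //.
by rewrite -(top j newj).
Qed.

End Unlinked.

(** * Exchanging points when #|S| > 2 *)

Section Exchange.
Variables k n : nat.
Local Notation pt := (points k.+1 n).
Local Notation one := (inord 1 : 'I_k.+1).
Implicit Types (x y z w : pt) (S : {set 'I_n}).

Lemma clt_trans (a b c : nat) (i j l : 'I_n) :
  clt a i b j -> clt b j c l -> clt a i c l.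
Proof. rewrite /clt; lia. Qed.

Lemma clt_irr (a : nat) (i : 'I_n) : clt a i a i = false.
Proof. rewrite /clt; lia. Qed.

Lemma clt_total (a b : nat) (i j : 'I_n) : i != j -> clt a i b j || clt b j a i.
Proof.
move=> ij; have : (i : nat) != j by [].
by rewrite /clt; clear; lia.
Qed.

Lemma clt_le_fst (a b : nat) (i j : 'I_n) : clt a i b j -> a <= b.
Proof. rewrite /clt; lia. Qed.

Lemma wt_full S x : x \in pts k S -> (forall q, q \in S -> x q != 0 :> nat) ->
  wt x = #|S|.
Proof.
rewrite inE => sx H; apply/eqP; rewrite eqn_leq subset_leq_card //=.
by apply: subset_leq_card; apply/subsetP=> q qS; rewrite inE H.
Qed.

Lemma full_wt S x q : x \in pts k S -> #|S| <= wt x -> q \in S -> x q != 0 :> nat.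
Proof.
rewrite inE => sx le_w; suff /eqP<- : supp x == S by rewrite inE.
by rewrite eqEcard sx.
Qed.

Lemma pts0 S x q : x \in pts k S -> q \notin S -> x q = 0 :> nat.
Proof. by move=> xS qS; apply/eqP; apply: contraNT qS; apply: in_pts. Qed.

Lemma wgt_mono (j : 'I_n) (c d : nat) : c <= d -> @wgt k n j c <= @wgt k n j d.
Proof.
have [->//|c0] := posnP c; rewrite leq_eqVlt => /predU1P[->//|lt_cd].
by apply/ltnW; rewrite wgt_lt // /clt ?lt_cd // (ltn_trans c0).
Qed.

Lemma key_mono x y : (forall j, x j <= y j) -> key x <= key y.
Proof. by move=> H; apply: leq_sum => j _; apply: wgt_mono. Qed.

Lemma inverted_clt S x y p q : inverted S x y p -> q \in S -> q != p ->
  clt (y q) q (y p) p.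
Proof. by case=> [_ _ _ _ H] qS /(H q qS)[_ /ltnW le_q]; apply: clt_le. Qed.

(** On [S], [p] carries the greatest pair of [y]. *)
Lemma inverted_top_uniq S x x' y p p' : inverted S x y p ->
  inverted S x' y p' -> p = p'.
Proof.
move=> bx bx'; apply/eqP/negPn/negP => ne; have [pS _ _ _ _] := bx.
have [p'S _ _ _ _] := bx'; have c' := inverted_clt bx' pS ne.
rewrite eq_sym in ne; have c := inverted_clt bx p'S ne.
by have := clt_trans c c'; rewrite clt_irr.
Qed.

(** Only at [p] does [x] take the value 1 on [S]. *)
Lemma inverted_one_uniq S x y y' p p' : inverted S x y p ->
  inverted S x y' p' -> p = p'.
Proof.
move=> [pS xp _ _ _] [_ _ _ _ H]; apply/eqP/negPn/negP => ne.
have [lt1 lt2 _] := H p pS ne.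
by move: (ltn_trans lt1 lt2); rewrite xp.
Qed.

(** At the top differing coordinate [t] the value of [x0] drops to 1, while at [p] it rises to a [c]
    such that [(c, p)] lies strictly between [(x0 t, t)] and [(x1 t, t)]. *)
Lemma ex_between S x0 x1 p : x0 \in pts k S -> x1 \in pts k S ->
  (forall q, q \in S -> x0 q != 0 :> nat) -> (forall q, q \in S ->
    x1 q != 0 :> nat) ->
  p \in S -> x0 p = 1 :> nat -> x1 p = 1 :> nat ->
  (forall q, q \in S -> q != p -> 1 < x0 q) ->
  key x0 < key x1 ->
  exists z t, [/\ z \in pts k S, key x0 <= key z, key z <= key x1, t \in S &
    [/\ t != p, z t = 1 :> nat & forall j, j != t -> j != p -> z j = x0 j]].
Proof.
move=> x0S x1S f0 f1 pS x0p x1p gt1 lt_x.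
have k0 : 0 < k by apply: (@k_gt0 k (x0 p)); rewrite x0p.
have one1 := oneE k0.
have eq_w : wt x0 = wt x1 by rewrite !(@wt_full S).
have [|[_ [t [lt_t wt_t]]]] := key_ltP lt_x; first by rewrite eq_w ltnn.
have tp : t != p by apply: contraTneq lt_t => ->; rewrite x0p x1p.
have pnt : p != t by rewrite eq_sym.
have tS : t \in S by apply: (in_pts x1S); rewrite -lt0n;
  apply: leq_ltn_trans lt_t.
(* The least value whose pair at [p] exceeds [(x0 t, t)]: equal values suffice exactly when
   [t < p]. *)
pose c : nat := if t < p then (x0 t : nat) else (x0 t).+1.
have le_c : c <= x1 t by rewrite /c; case: ifP => _ //; apply: ltnW.
have c_ord : c < k.+1 := leq_ltn_trans le_c (ltn_ord _).
pose z := upd (upd x0 t one) p (Ordinal c_ord).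
have c1 : 1 < c by have := gt1 t tS tp; rewrite /c; clear; case: ifP; lia.
have cx0 : clt (x0 t) t c p.
  by rewrite /clt /c; have := pnt; rewrite -val_eqE /=; clear; case: ifP; lia.
have cx1 : clt c p (x1 t) t.
  have := pnt; move: lt_t; rewrite /clt /c -val_eqE /=; clear; case: ifP; lia.
have zp : z p = c :> nat by rewrite updE eqxx.
have zt : z t = 1 :> nat by rewrite !updE (negbTE tp) eqxx one1.
have zj j : j != t -> j != p -> z j = x0 j.
  by move=> jt jp; rewrite !updE (negbTE jt) (negbTE jp).
have zS : z \in pts k S by rewrite !pts_upd.
have fz q : q \in S -> z q != 0 :> nat.
  move=> qS; have [->|qp] := eqVneq q p;
    first by rewrite zp -lt0n (ltn_trans _ c1).
  by have [->|qt] := eqVneq q t; [rewrite zt|rewrite zj // f0].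
have wz : wt z = #|S| := wt_full zS fz.
exists z, t; split=> //.
  apply/ltnW/(key_wit (t := p)); first by rewrite wz (wt_full x0S).
  split; first by rewrite zp x0p.
  move=> j; have [->|jt] := eqVneq j t.
    move=> _ _; rewrite zt zp; split=> //; apply: clt_le cx0.
    exact: ltnW (gt1 t tS tp).
  by move=> /[swap] jp; rewrite zj // eqxx.
apply/ltnW/(key_wit (t := t)); first by rewrite wz (wt_full x1S).
split; first by rewrite zt (ltn_trans (gt1 t tS tp)).
move=> j; have [->|jp] := eqVneq j p.
  by move=> _ _; rewrite zp x1p; split=> //; apply: clt_le cx1; apply: ltnW.
by move=> /[swap] jt; rewrite zj // => /wt_t; apply.
Qed.

Lemma ex_third S (i j : 'I_n) : 2 < #|S| -> exists l, [/\ l \in S,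
  l != i & l != j].
Proof.
move=> cS; have : ~~ (S \subset [set i; j]).
  apply: contraL cS => /subset_leq_card; rewrite -leqNgt => /leq_trans; apply.
  by rewrite cards2; case: eqP.
by case/subsetPn=> l lS; rewrite !inE negb_or => /andP[]; exists l.
Qed.

Section ExchangeSum.
Variables (S : {set 'I_n}) (A B : {set pt}).
Hypotheses (sA : A \subset pts k S) (cA : compressed S A) (iB : initS S B).
Hypotheses (eqAB : #|B| = #|A|) (S_gt2 : 2 < #|S|).
Hypothesis wB : forall f, f \in A :\: B -> 1 < wt f.

Let AS x : x \in A -> x \in pts k S. Proof. exact: (subsetP sA). Qed.
Let BS x : x \in B -> x \in pts k S. Proof. exact: (subsetP iB.1). Qed.

Lemma key_sep e f : e \in B :\: A -> f \in A :\: B -> key e < key f.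
Proof.
move=> /setDP[eB eA] /setDP[fA fB]; rewrite ltnNge; apply: contra fB => le_fe.
exact: (iB.2 _ _ (AS fA) eB).
Qed.

Lemma nu_dichotomy e f : e \in B :\: A -> f \in A :\: B -> nu S e <= nu S f \/
  [/\ nu S e = 1, nu S f = 0 & exists p, inverted S e f p].
Proof.
move=> eE fF; have lt_ef := key_sep eE fF; have w := wB fF.
move: eE fF => /setDP[eB eA] /setDP[fA fB].
apply: unlinked_nu => //; [exact: BS | exact: AS |].
exact: compressed_unlinked cA (BS eB) eA fA.
Qed.

Section InvertedPair.
Variables (x y : pt) (p : 'I_n).
Hypotheses (xE : x \in B :\: A) (yF : y \in A :\: B).
Hypotheses (nux : nu S x = 1) (nuy : nu S y = 0) (bxy : inverted S x y p).

Lemma inverted_of e : e \in B :\: A -> 0 < nu S e ->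
  nu S e = 1 /\ inverted S e y p.
Proof.
move=> eE nue; have [|[e1 _ [p' be]]] := nu_dichotomy eE yF.
  by rewrite nuy leqNgt nue.
by rewrite (inverted_top_uniq bxy be).
Qed.

(* The point [z] of [ex_between] would be inverted with [y], although it has
   the value 1 off the top coordinate [p]. *)
Lemma inverted_key_inj e e' : e \in B :\: A -> e' \in B :\: A -> 0 < nu S e ->
  0 < nu S e' -> key e < key e' -> False.
Proof.
move=> eE e'E nue nue' lt_e.
have [_ [pS ep yp fe He]] := inverted_of eE nue.
have [_ [_ e'p _ fe' He']] := inverted_of e'E nue'.
have /setDP[eB eA] := eE; have /setDP[e'B e'A] := e'E.
have gt1 q : q \in S -> q != p -> 1 < e q.
  by move=> qS qp; have [y1 /(ltn_trans y1)] := He q qS qp.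
have [z [t [zS le_ez le_ze' tS [tp zt zj]]]] :=
  ex_between (BS eB) (BS e'B) fe fe' pS ep e'p gt1 lt_e.
have zE : z \in B :\: A.
  rewrite inE (iB.2 _ _ zS e'B) // andbT; apply: contra eA => zA.
  (* At a third coordinate [z] agrees with [e], so [z] in [A] would put [e] in [A] by
     compression. *)
  have [l [lS lt lp]] := ex_third t p S_gt2.
  by apply: (cA (BS eB) zA lS _ le_ez); rewrite zj.
have fz q : q \in S -> z q != 0 :> nat.
  apply: (full_wt zS); rewrite -(wt_full (BS eB) fe); exact: key_wt.
have newz : fresh S z t by apply/freshP; split=> // l lS _; apply: fz.
have [|_ [_ _ _ _ /(_ t tS tp)[y1 y2 _]]] := @inverted_of z zE.
  by apply/card_gt0P; exists t; rewrite inE.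
by move: (ltn_trans y1 y2); rewrite zt.
Qed.

Lemma sum_nu_E : \sum_(e in B :\: A) nu S e <= 1.
Proof.
rewrite (bigD1 x) //= nux big1 ?addn0 // => e /andP[eE ex]; apply/eqP.
rewrite -leqn0 leqNgt; apply/negP=> nue; have nux0 : 0 < nu S x by rewrite nux.
case: (ltngtP (key e) (key x)) => [||/key_inj e_x];
  last by rewrite e_x eqxx in ex.
  exact: inverted_key_inj.
exact: inverted_key_inj.
Qed.

(* Otherwise every point of [A :\: B] is inverted with [x].  Such points differ
   from the greatest one [m] only at the coordinate [t], and [f |-> f t] embeds
   them into the points [upd x p d] with [1 < d < m p], which lie in [B :\: A]
   but miss [x]. *)
Lemma ex_nu_F : exists2 f, f \in A :\: B & 0 < nu S f.
Proof.
have [/existsP[f /andP[fF nuf]]|] := boolP [exists f, (f \in A :\: B) &&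
  (0 < nu S f)].
  by exists f.
move/existsPn=> nu0; exfalso.
have {}nu0 f : f \in A :\: B -> nu S f = 0.
  by move=> fF; apply/eqP; rewrite -leqn0 leqNgt; have := nu0 f; rewrite fF.
have notfresh f s : f \in A :\: B -> ~~ fresh S f s.
  move=> fF; have /eqP := nu0 f fF; rewrite cards_eq0 => /eqP/setP/(_ s).
  by rewrite !inE => ->.
have invF f : f \in A :\: B -> inverted S x f p.
  move=> fF; have [|[_ _ [p' bf]]] := nu_dichotomy xE fF;
    first by rewrite nux nu0.
  by rewrite (inverted_one_uniq bxy bf).
have [m mF max_m] := @arg_maxnP _ y (mem (A :\: B)) (@key k n) yF.
have [pS xp mp fx Hm] := invF m mF.
have [mA mB] := setDP mF; have [xB xA] := setDP xE.
have k0 : 0 < k by apply: (@k_gt0 k (x p)); rewrite xp.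
have one1 := oneE k0.
have fullF f q : f \in A :\: B -> q \in S -> f q != 0 :> nat.
  move=> fF qS; have [_ _ fp _ Hf] := invF f fF.
  have [->|qp] := eqVneq q p; first by rewrite -lt0n; apply: ltnW.
  by have [f1 _ _] := Hf q qS qp; rewrite -lt0n; apply: ltnW.
have [s [sS sp _]] := ex_third p p S_gt2.
(* The least point non-zero on [S] with value [m p] at [p]. It lies in [A] through [m], and in [B]
   because otherwise its fresh coordinate [s] contradicts [notfresh]. *)
pose y' : pt := [ffun q => if q \in S then if q == p then m p else one else ord0].
have y'E q : y' q = (if q \in S then if q == p then m p else one else ord0) by
  rewrite ffunE.
have y'p : y' p = m p by rewrite y'E pS eqxx.
have y'q q : q \in S -> q != p -> y' q = 1 :> nat.
  by move=> qS qp; rewrite y'E qS (negbTE qp) one1.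
have y'S : y' \in pts k S by apply: ptsP => q; rewrite y'E; case: ifP.
have fy' q : q \in S -> y' q != 0 :> nat.
  move=> qS; have [->|qp] := eqVneq q p; first by rewrite y'p fullF.
  by rewrite y'q.
have le_y'm : key y' <= key m.
  apply: key_mono => q; rewrite y'E; case: ifP => // qS; case: eqP => [->//|_].
  by rewrite one1 lt0n fullF.
have wit_y' (d : 'I_k.+1) : d < m p -> d != 0 :> nat -> key (upd x p d) < key y'.
  move=> lt_d d0; apply: (key_wit (t := p)).
    rewrite !(@wt_full S) ?pts_upd ?(BS xB) // => q qS; rewrite updE.
    by case: (q =P p) => // _; apply: fx.
  split; first by rewrite updE eqxx y'p.
  move=> j; rewrite y'p updE => /[swap] jp; rewrite (negbTE jp).
  have [jS|jS] := boolP (j \in S); last first.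
    by move/eqP; case; apply: val_inj; rewrite /= (pts0 (BS xB) jS) (pts0 y'S jS).
  move=> _; have [_ _ cj] := Hm j jS jp; split=> //; rewrite y'q //.
  by apply: clt_le cj; rewrite lt0n fx.
have lt_xy' : key x < key y'.
  by have := wit_y' (x p); rewrite upd_id; apply; rewrite xp.
have y'A : y' \in A.
  by apply: (cA y'S mA pS).
have y'B : y' \in B.
  apply/negPn/negP => y'B; have y'F : y' \in A :\: B by rewrite inE y'A y'B.
  have /negP := notfresh y' s y'F; apply; apply/freshP; split=> //;
    first exact: y'q.
  by move=> l lS _; apply: fy'.
have updE_E (d : 'I_k.+1) : d < m p -> 1 < d -> upd x p d \in (B :\: A) :\ x.
  move=> lt_d d1; rewrite !inE.
  have uS : upd x p d \in pts k S by rewrite pts_upd ?BS.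
  have -> : upd x p d \in B.
    apply: (iB.2 _ _ uS y'B); apply/ltnW/wit_y' => //.
    by rewrite -lt0n; apply: ltnW.
  rewrite andbT; apply/andP; split.
    by apply: contraTneq d1 => /ffunP/(_ p); rewrite updE eqxx => ->; rewrite xp.
  apply: contra xA => uA; apply: (cA (BS xB) uA sS);
    first by rewrite updE (negbTE sp).
  by apply: key_mono => j; rewrite updE; case: (j =P p) => [->|//];
    rewrite xp ltnW.
have [t [tS tp] min_t] : exists2 t, t \in S /\ t != p & forall q, q \in S ->
  q != p ->
    ~~ clt (m q) q (m t) t.
  pose P := [pred q | (q \in S) && (q != p)].
  have Ps : P s by rewrite /= sS sp.
  have [t /andP[tS tp] min_t] := @arg_minnP _ s P (fun q => code (m q) q) Ps.
  exists t => // q qS qp; rewrite -code_lt -leqNgt; apply: min_t.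
  by rewrite /= qS qp.
have only_t f j : f \in A :\: B -> j != t -> f j = m j.
  move=> fF jt; have [->//|ne_fm] := eqVneq f m.
  have [fA fB] := setDP fF.
  have lt_fm : key f < key m by rewrite key_lt_neq ne_fm; apply: max_m.
  have wf g : g \in A :\: B -> wt g = #|S|.
    by move=> gF; apply: wt_full => [|q qS];
      [case/setDP: gF => /AS | apply: fullF].
  have [|[_ [u [lt_u wit_u]]]] := key_ltP lt_fm; first by rewrite !wf ?ltnn.
  have uS : u \in S.
    by apply: (in_pts (AS mA)); rewrite -lt0n; apply: leq_ltn_trans lt_u.
  (* If [q] had a smaller pair than [u], lowering [m q] to 1 would give a point of [A] above [f],
     thus in [A :\: B], with [q] fresh. *)
  have above q : q \in S -> q != p -> q != u -> clt (m u) u (m q) q.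
    move=> qS qp qu; have := clt_total (m u) (m q) (i := u) (j := q).
    rewrite eq_sym qu => /(_ isT) /orP[//|lt_q]; exfalso.
    pose z := upd m q one.
    have zS : z \in pts k S by rewrite pts_upd ?AS.
    have fz l : l \in S -> z l != 0 :> nat.
      by move=> lS; rewrite updE; case: (l =P q) => _; rewrite ?one1 ?fullF.
    have zA : z \in A.
      apply: (cA zS mA pS); first by rewrite updE eq_sym (negbTE qp).
      apply: key_mono => l; rewrite updE; case: (l =P q) => [->|//].
      by rewrite one1 lt0n fullF.
    have lt_fz : key f < key z.
      apply: (key_wit (t := u)); first by rewrite wf // (wt_full zS).
      have zu : z u = m u by rewrite updE eq_sym (negbTE qu).
      split; first by rewrite zu.
      move=> l; rewrite zu updE; have [->|lq] := eqVneq l q; last exact: wit_u.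
      rewrite one1 => _ _; split; last by apply: clt_le lt_q; rewrite lt0n fullF.
      have [->//|ne_q] := eqVneq (f q) (m q); by case: (wit_u q ne_q qu).
    have zF : z \in A :\: B.
      rewrite inE zA andbT; apply: contra fB => zB.
      exact: (iB.2 _ _ (AS fA) zB (ltnW lt_fz)).
    have /negP := notfresh z q zF; apply; apply/freshP; split=> //.
      by rewrite updE eqxx.
    by move=> l lS _; apply: fz.
  have up : u != p.
    apply/negP=> /eqP eup; have := above s sS sp; rewrite eup => /(_ sp) c1.
    by have := clt_trans c1 (inverted_clt (invF m mF) sS sp); rewrite clt_irr.
  have eut : u = t.
    apply/eqP/negPn/negP => ut; have := min_t u uS up.
    by rewrite above // eq_sym.
  have ju : j != u by rewrite eut.
  apply/eqP/negPn/negP => ne; have [_ c1] := wit_u j ne ju.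
  have jS : j \in S.
    apply: contraNT ne => jS; apply/eqP/val_inj.
    by rewrite /= (pts0 (AS fA) jS) (pts0 (AS mA) jS).
  have [ejp|jp] := eqVneq j p.
    rewrite ejp in c1; have := clt_trans c1 (inverted_clt (invF m mF) uS up).
    by rewrite clt_irr.
  by have := clt_trans c1 (above j jS jp ju); rewrite clt_irr.
have inj_t : {in A :\: B &, injective (fun f : pt => upd x p (f t))}.
  move=> f g fF gF e; apply/ffunP=> j; have [->|jt] := eqVneq j t.
    by move/ffunP/(_ p): e; rewrite !updE eqxx.
  by rewrite !only_t.
have : [set (fun f : pt => upd x p (f t)) f | f in A :\: B] \subset (B :\:
  A) :\ x.
  apply/subsetP=> w /imsetP[f fF ->];
    have [_ _ _ _ /(_ t tS tp)[f1 f2 _]] := invF f fF.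
  apply: updE_E => //; apply: leq_trans f2 _.
  by have [_ _ /clt_le_fst] := Hm t tS tp.
move=> /subset_leq_card; rewrite card_in_imset // -(card_setD_eq eqAB).
by rewrite [X in X <= _](cardsD1 x) xE add1n ltnn.
Qed.

End InvertedPair.

(** If [nu] never drops from [B :\: A] to [A :\: B], the sums compare directly. A drop yields an
    inverted pair, and then the first sum is at most 1 and the second positive. *)
Lemma sum_nu_compressed : \sum_(b in B) nu S b <= \sum_(a in A) nu S a.
Proof.
rewrite (sum_setIDE B A) (sum_setIDE A B) setIC leq_add2l.
have [/exists_inP[x xE /exists_inP[y yF lt_yx]]|no_bad] :=
    boolP [exists x in B :\: A, exists y in A :\: B, nu S y < nu S x].
  have [|[nux nuy [p bxy]]] := nu_dichotomy xE yF; first by rewrite leqNgt lt_yx.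
  apply: leq_trans (sum_nu_E xE yF nux nuy bxy) _.
  have [f fF nuf] := ex_nu_F xE yF nux bxy.
  by rewrite (bigD1 f) //=; apply: leq_trans (leq_addr _ _).
have := @sum_separated _ (B :\: A) (A :\: B) (nu S) 0 (card_setD_eq eqAB).
rewrite mul0n addn0; apply=> e f eE fF; rewrite addn0 leqNgt.
apply: contra no_bad => lt_fe; apply/exists_inP; exists e => //.
by apply/exists_inP; exists f.
Qed.

End ExchangeSum.
End Exchange.

(** * Two coordinates *)

Section TwoCoordinates.
Variables k n : nat.
Local Notation pt := (points k.+1 n).
Local Notation one := (inord 1 : 'I_k.+1).
Implicit Types (x y z w : pt) (A B : {set pt}).

Lemma card_ord_interval m : m <= k -> #|[set c : 'I_k.+1 | 0 < c <= m]| = m.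
Proof.
move=> le_mk; rewrite -[RHS]card_ord -cardsT.
rewrite -(card_in_imset (f := fun i : 'I_m => inord i.+1 : 'I_k.+1)).
  apply: eq_card => c; rewrite inE; apply/andP/imsetP.
    move=> [c0 cm]; have lt_c : c.-1 < m by rewrite prednK.
    exists (Ordinal lt_c) => //; apply: val_inj; rewrite /= prednK //.
    by rewrite inordK.
  move=> [i _ ->]; have := ltn_ord i => im.
  by rewrite inordK // ltnS (leq_trans im).
move=> i j _ _ /(congr1 val); have := ltn_ord i; have := ltn_ord j => jm im.
rewrite /= !inordK ?ltnS ?(leq_trans im) ?(leq_trans jm) //.
by move=> [] /val_inj.
Qed.

Variables s t : 'I_n.
Hypothesis lt_st : s < t.
Let S := [set s; t].
Let st : s != t. Proof. exact: lt_ord_neq. Qed.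
Let ts : t != s. Proof. by rewrite eq_sym. Qed.

Definition pair_pt (a b : 'I_k.+1) : pt :=
  [ffun j => if j == s then a else if j == t then b else ord0].

Definition rows A := [set a : 'I_k.+1 | (0 < a) && [exists b : 'I_k.+1,
  (0 < b) && (pair_pt a b \in A)]].
Definition cols A := [set b : 'I_k.+1 | (0 < b) && [exists a : 'I_k.+1,
  (0 < a) && (pair_pt a b \in A)]].
Definition full A := [set x in A | 1 < wt x].

Lemma pair_ptE a b j : pair_pt a b j = if j == s then a else if j == t then b
  else ord0.
Proof. by rewrite ffunE. Qed.

Lemma pair_pts a b : pair_pt a b s = a. Proof. by rewrite pair_ptE eqxx. Qed.
Lemma pair_ptt a b : pair_pt a b t = b.
Proof. by rewrite pair_ptE (negbTE ts) eqxx. Qed.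

Lemma pair_pt_in a b : pair_pt a b \in pts k S.
Proof.
apply: ptsP => j; rewrite pair_ptE !inE.
by case: (j =P s) => //; case: (j =P t).
Qed.

Lemma pair_ptK x : x \in pts k S -> pair_pt (x s) (x t) = x.
Proof.
move=> xS; apply/ffunP=> j; rewrite pair_ptE; case: eqP => [->//|/eqP js].
case: eqP => [->//|/eqP jt]; apply: val_inj; rewrite /= (pts0 xS) //.
by rewrite !inE negb_or js.
Qed.

Lemma pair_pt_inj a b c d : pair_pt a b = pair_pt c d -> a = c /\ b = d.
Proof.
by move=> e; split; [rewrite -(pair_pts a b) e pair_pts|rewrite -(pair_ptt a b)
  e pair_ptt].
Qed.

Lemma sS : s \in S. Proof. by rewrite !inE eqxx. Qed.
Lemma tS : t \in S. Proof. by rewrite !inE eqxx orbT. Qed.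

Lemma wt_pair_pt a b : wt (pair_pt a b) = (0 < a) + (0 < b).
Proof.
have H (c : 'I_k.+1) : (c != 0 :> nat) = (0 < c) by rewrite lt0n.
have -> : wt (pair_pt a b) = #|[set j in S | pair_pt a b j != 0 :> nat]|.
  apply: eq_card => j; rewrite !inE pair_ptE.
  by case: (j =P s) => //; case: (j =P t).
rewrite -sum1_card; under eq_bigl do rewrite inE.
rewrite big_mkcondr /= big_setU1 ?inE //= big_set1 pair_pts pair_ptt !H.
by case: (0 < a); case: (0 < b).
Qed.

Lemma full_pair A x : A \subset pts k S -> x \in full A ->
  [/\ 0 < x s, 0 < x t & pair_pt (x s) (x t) \in A].
Proof.
move=> sA; rewrite inE => /andP[xA]; have xS := subsetP sA _ xA.
rewrite -{1}(pair_ptK xS) wt_pair_pt pair_ptK //.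
by case: (0 < x s); case: (0 < x t).
Qed.

Lemma card_full_le A : A \subset pts k S -> #|full A| <= #|rows A| * #|cols A|.
Proof.
move=> sA; rewrite -cardsX.
rewrite -(card_in_imset (f := fun x : pt => (x s, x t))) => [|x y]; last first.
  rewrite !inE => /andP[/(subsetP sA) xS _] /andP[/(subsetP sA) yS _] [e1 e2].
  by rewrite -(pair_ptK xS) -(pair_ptK yS) e1 e2.
apply: subset_leq_card; apply/subsetP=> u /imsetP[x xA ->].
have [x1 x2 xx] := full_pair sA xA; rewrite !inE /= x1 x2 /=.
by apply/andP; split; apply/existsP; [exists (x t)|exists (x s)]; rewrite ?x1 ?x2.
Qed.

(* Projections of the full points to the two axes, together with the origin. *)
Definition border A : {set 'I_k.+1 * 'I_k.+1} :=
  (ord0, ord0) |: (setX (rows A) [set ord0] :|: setX [set ord0] (cols A)).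

Lemma card_border A : #|border A| = (#|rows A| + #|cols A|).+1.
Proof.
rewrite cardsU1 !inE /= ?andbF /= add1n cardsU !cardsX !cards1 muln1 mul1n.
rewrite (_ : _ :&: _ = set0) ?cards0 ?subn0 //.
by apply/setP=> -[a b]; rewrite !inE /=; apply/negbTE/negP;
  case: (a =P ord0) => [->|] //=;
   rewrite ?andbF.
Qed.

(** By compression a full point puts an axis point into [A], hence the origin into the shadow;
    zeroing one value of full points gives the rest. *)
Lemma border_shadow A : A \subset pts k S -> compressed S A -> full A != set0 ->
  #|border A| <= #|shadow A|.
Proof.
move=> sA cA /set0Pn[x xF]; have [x1 x2 xA] := full_pair sA xF.
rewrite -(card_in_imset (f := fun u => pair_pt u.1 u.2)); last first.
  by move=> [a b] [c d] _ _ /= /pair_pt_inj[-> ->].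
apply: subset_leq_card; apply/subsetP=> w /imsetP[[a b]].
rewrite !inE /= => /predU1P[[-> ->] ->|/orP[]].
- apply/mem_shadow; exists (pair_pt (x s) ord0), s; split.
  + apply: (cA _ _ s (pair_pt_in _ _) xA sS); first by rewrite !pair_pts.
    by apply: key_mono => j; rewrite !pair_ptE; case: (j =P s) => // _;
      case: (j =P t).
  + by rewrite pair_pts -lt0n.
  by apply/ffunP=> j; rewrite updE !pair_ptE; case: (j =P s).
- case/andP=> /andP[a0 /existsP[c /andP[c0 acA]]] /eqP-> ->.
  apply/mem_shadow; exists (pair_pt a c), t; rewrite pair_ptt -lt0n; split=> //.
  apply/ffunP=> j; rewrite updE !pair_ptE; case: (j =P t) => // ->.
  by rewrite (negbTE ts).
case/andP=> /eqP-> /andP[b0 /existsP[c /andP[c0 acA]]] ->.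
apply/mem_shadow; exists (pair_pt c b), s; rewrite pair_pts -lt0n; split=> //.
by apply/ffunP=> j; rewrite updE !pair_ptE; case: (j =P s).
Qed.

Lemma shadow_border B : initS S B -> #|shadow B| <= #|border B|.
Proof.
move=> [sB downB].
rewrite -(card_in_imset (f := fun u => pair_pt u.1 u.2)); last first.
  by move=> [a b] [c d] _ _ /= /pair_pt_inj[-> ->].
apply: subset_leq_card; apply/subsetP=> w /mem_shadow[x [j [xB xj ->]]].
have xS := subsetP sB _ xB; have := in_pts xS xj; rewrite !inE => /orP[] /eqP ej.
  apply/imsetP; exists (ord0, x t); last first.
    rewrite ej -{1}(pair_ptK xS) /=; apply/ffunP=> l; rewrite updE !pair_ptE.
    by case: (l =P s).
  rewrite !inE /=; have [->|x0] := eqVneq (x t) ord0; first by rewrite eqxx.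
  apply/orP; right; rewrite ?eqxx lt0n x0 /=.
  by apply/existsP; exists (x s); rewrite pair_ptK // lt0n -ej xj.
apply/imsetP; exists (x s, ord0); last first.
  rewrite ej -{1}(pair_ptK xS) /=; apply/ffunP=> l; rewrite updE !pair_ptE.
  by case: (l =P t) => [->|]; rewrite ?(negbTE ts).
rewrite !inE /=; have [->|x0] := eqVneq (x s) ord0; first by rewrite eqxx.
apply/orP; right; apply/orP; left; rewrite eqxx lt0n x0 andbT /=.
by apply/existsP; exists (x t); rewrite pair_ptK // lt0n -ej xj.
Qed.

(** The grid points lie below [x], so they are full points of [B]; the strictness comes from [x]
    itself. *)
Lemma full_grid B (P Q : {set 'I_k.+1}) x : initS S B -> x \in B ->
  (forall c, c \in P -> 0 < c) -> (forall c, c \in Q -> 0 < c) -> 1 < wt x ->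
  (forall a b, a \in P -> b \in Q -> key (pair_pt a b) < key x) ->
  #|P| * #|Q| < #|full B|.
Proof.
move=> [sB downB] xB P0 Q0 wx H; rewrite -cardsX.
rewrite -(card_in_imset (f := fun u => pair_pt u.1 u.2)); last first.
  by move=> [a b] [c d] _ _ /= /pair_pt_inj[-> ->].
apply: proper_card; apply/properP; split.
  apply/subsetP=> w /imsetP[[a b] /setXP[/= aP bQ] ->]; rewrite inE wt_pair_pt.
  by rewrite P0 // Q0 // andbT (downB _ x) ?pair_pt_in // ltnW ?H.
exists x; first by rewrite inE xB.
apply/imsetP=> -[[a b] /setXP[/= aP bQ] ex].
by have := H a b aP bQ; rewrite ex ltnn.
Qed.

(** Points with both values in [1 .. x s - 1] precede [pair_pt (x s) one], which is at most [x]. *)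
Lemma rows_bound B x : initS S B -> x \in B -> 1 < wt x ->
  (x s).-1 * (x s).-1 < #|full B|.
Proof.
move=> iB xB wx; have sB := iB.1; have xS := subsetP sB _ xB.
have [x1 x2 _] : [/\ 0 < x s, 0 < x t & pair_pt (x s) (x t) \in B].
  by apply: full_pair; rewrite ?inE ?xB.
have le_x : (x s).-1 <= k by have := ltn_ord (x s); lia.
have k0 : 0 < k by apply: (@k_gt0 k (x s)); rewrite -lt0n.
rewrite -{1 2}(card_ord_interval le_x).
apply: (@full_grid _ _ _ x) => // [c|c|a b]; rewrite ?inE; try by case/andP.
move=> /andP[a0 ax] /andP[b0 bx].
apply: (@leq_trans (key (pair_pt (x s) one))).
  apply: (key_wit (t := s)); first by rewrite !wt_pair_pt oneE // x1 a0 b0.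
  split; first by rewrite !pair_pts; move: ax x1; clear; lia.
  move=> j _ js; rewrite pair_pts !pair_ptE (negbTE js).
  have lt_b : b < x s by move: bx x1; clear; lia.
  by rewrite /clt; case: (j =P t) => _;
    rewrite ?oneE ?lt_b ?(leq_ltn_trans b0 lt_b) ?x1.
apply: key_mono => j; rewrite pair_ptE; case: (j =P s) => [->//|_].
by case: (j =P t) => [->|//]; rewrite oneE.
Qed.

(** As [s < t], a value at [s] may equal [x t] and still be dominated by the pair at [t]; the grid
    has one more value at [s] than at [t]. *)
Lemma cols_bound B x : initS S B -> x \in B -> 1 < wt x ->
  x t * (x t).-1 < #|full B|.
Proof.
move=> iB xB wx; have sB := iB.1; have xS := subsetP sB _ xB.
have [x1 x2 _] : [/\ 0 < x s, 0 < x t & pair_pt (x s) (x t) \in B].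
  by apply: full_pair; rewrite ?inE ?xB.
have le_x : x t <= k by rewrite -ltnS.
have le_x' : (x t).-1 <= k := leq_trans (leq_pred _) le_x.
have k0 : 0 < k by apply: (@k_gt0 k (x t)); rewrite -lt0n.
rewrite -{1}(card_ord_interval le_x) -{1}(card_ord_interval le_x').
apply: (@full_grid _ _ _ x) => // [c|c|a b]; rewrite ?inE; try by case/andP.
move=> /andP[a0 ax] /andP[b0 bx].
apply: (@leq_trans (key (pair_pt one (x t)))).
  apply: (key_wit (t := t)); first by rewrite !wt_pair_pt oneE // x2 a0 b0.
  split; first by rewrite !pair_ptt; move: bx x2; clear; lia.
  move=> j _ jt; rewrite pair_ptt !pair_ptE (negbTE jt).
  case: (j =P s) => [->|_]; last by rewrite /clt x2.
  by rewrite /clt oneE // lt_st !andbT; move: ax x2; clear; lia.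
apply: key_mono => j; rewrite pair_ptE; case: (j =P s) => [->|_];
  first by rewrite oneE.
by case: (j =P t) => [->|//].
Qed.

(** With [u = b - d] the other factor is at most [b + d + e], and the product is greatest at
    [d = 0]. *)
Lemma mul_le_balanced (u v b e : nat) : e <= 1 -> u <= b -> u + v <= b + b + e ->
  u * v <= b * (b + e).
Proof.
move=> e1 /subnKC<-; move: (b - u) => d; rewrite -!addnA leq_add2l => le_v.
apply: (leq_trans (leq_mul (leqnn u) le_v)); nia.
Qed.

(** If [r + c < a + b], a balanced split bounds [r * c] by [b * b.-1] when [a <= b] and by
    [a.-1 * a.-1] otherwise. *)
Lemma semiperimeter (r c a b F : nat) : 0 < a -> 0 < b -> F <= r * c ->
  a.-1 * a.-1 < F -> b * b.-1 < F -> a + b <= r + c.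
Proof.
case: a b => [//|a] [//|b] _ _ le_F /= ltaF ltbF; rewrite leqNgt;
  apply/negP=> lt_rc.
have [le_ab|lt_ba] := leqP a b.
  have H : r * c <= b.+1 * b.
    rewrite [X in _ <= X]mulnC -addn1; have [le_rb|lt_br] := leqP r b.
      by apply: mul_le_balanced => //; lia.
    by rewrite mulnC; apply: mul_le_balanced => //; lia.
  by have := leq_ltn_trans (leq_trans le_F H) ltbF; rewrite ltnn.
have H : r * c <= a * a.
  rewrite -[X in _ <= _ * X]addn0; have [le_ra|lt_ar] := leqP r a.
    by apply: mul_le_balanced => //; lia.
  by rewrite mulnC; apply: mul_le_balanced => //; lia.
by have := leq_ltn_trans (leq_trans le_F H) ltaF; rewrite ltnn.
Qed.

Lemma shadow_min2 A B b0 : A \subset pts k S -> compressed S A -> initS S B ->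
  #|B| = #|A| -> b0 \in B -> 1 < wt b0 -> #|shadow B| <= #|shadow A|.
Proof.
move=> sA cA iB eqBA b0B wb0; have sB := iB.1.
have b0F : b0 \in full B by rewrite inE b0B.
(* As [B] has a full point, it contains every lighter point of [A]; so [B] has at least as many
   non-full points, and [A] at least as many full ones. *)
have le_full : #|full B| <= #|full A|.
  have sub : A :\: full A \subset B :\: full B.
    apply/subsetP=> x; rewrite !inE negb_and => /andP[nx xA].
    rewrite xA /= -leqNgt in nx; rewrite ltnNge nx /= andbF /=.
    apply: (iB.2 _ _ (subsetP sA _ xA) b0B); apply/ltnW/key_lt_wt.
    exact: leq_ltn_trans wb0.
  have sF C : C :&: full C = full C by apply/setIidPr/subsetP=> x;
    rewrite inE => /andP[].
  have := subset_leq_card sub; have := cardsID (full A) A;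
    have := cardsID (full B) B.
  by rewrite !sF eqBA; clear; lia.
apply: leq_trans (shadow_border iB) (leq_trans _ (border_shadow sA cA _));
  last first.
  by rewrite -card_gt0 (leq_trans _ le_full) // card_gt0; apply/set0Pn; exists b0.
rewrite !card_border ltnS.
have [x xF max_x] := @arg_maxnP _ b0 (mem (full B)) (fun x : pt => x s : nat) b0F.
have [y yF max_y] := @arg_maxnP _ b0 (mem (full B)) (fun x : pt => x t : nat) b0F.
have [x1 _ _] := full_pair sB xF; have [_ y2 _] := full_pair sB yF.
have [xB wx] := setIdP xF; have [yB wy] := setIdP yF.
apply: (@leq_trans (x s + y t)); last first.
  apply: semiperimeter x1 y2 (leq_trans le_full (card_full_le sA)) _ _.
    exact: rows_bound.
  exact: cols_bound.
have le_xs : x s <= k by rewrite -ltnS.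
have le_yt : y t <= k by rewrite -ltnS.
rewrite -{1}(card_ord_interval le_xs) -{1}(card_ord_interval le_yt).
have inF (a b : 'I_k.+1) : 0 < a -> 0 < b -> pair_pt a b \in B ->
  pair_pt a b \in full B.
  by move=> a0 b_0 abB; rewrite inE abB wt_pair_pt a0 b_0.
apply: leq_add; apply: subset_leq_card; apply/subsetP=> c; rewrite !inE.
  move=> /andP[c0 /existsP[b /andP[b_0 cbB]]]; rewrite c0 /=.
  by have := max_x _ (inF _ _ c0 b_0 cbB); rewrite pair_pts.
move=> /andP[c0 /existsP[a /andP[a_0 acB]]]; rewrite c0 /=.
by have := max_y _ (inF _ _ a_0 c0 acB); rewrite pair_ptt.
Qed.

End TwoCoordinates.

(** * Induction on the coordinate set *)

Section Main.
Variables k n : nat.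
Local Notation pt := (points k.+1 n).
Implicit Types (x y : pt) (A B : {set pt}) (S : {set 'I_n}).

(** The shadow of [B] is at most the origin. If it is non-empty, [B] has two points, so [A] has a
    non-zero point and a non-empty shadow. *)
Lemma shadow_light S A B : initS S B -> #|B| = #|A| ->
  (forall b, b \in B -> wt b <= 1) -> #|shadow B| <= #|shadow A|.
Proof.
move=> iB eqBA light; have [->|[w wB]] := set_0Vmem (shadow B);
  first by rewrite cards0.
pose o : pt := [ffun => ord0].
have wt0 x : wt x = 0 -> x = o.
  move=> /eqP; rewrite cards_eq0 => /eqP/setP H; apply/ffunP=> j; apply: val_inj.
  by have := H j; rewrite !inE ffunE => /negbFE/eqP.
have sub : shadow B \subset [set o].
  apply/subsetP=> z /mem_shadow[x [j [xB xj ->]]]; rewrite inE; apply/eqP/wt0.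
  by have := light x xB; rewrite -(wt_upd0 xj); case: (wt _).
apply: leq_trans (subset_leq_card sub) _; rewrite cards1 card_gt0.
have [x [j [xB xj def_w]]] := mem_shadow _ _ wB.
have wS : w \in pts k S by rewrite def_w pts_upd0 ?(subsetP iB.1).
have wB' : w \in B.
  by apply: (iB.2 _ _ wS xB); apply/ltnW/key_lt_wt; rewrite def_w -(wt_upd0 xj).
have nxw : x != w by apply: contraNneq xj => ->; rewrite def_w updE eqxx.
have : 1 < #|A| by rewrite -eqBA; apply/card_gt1P; exists x, w.
move=> /card_gt1P[a [b [aA bA ab]]].
have [c cA /eqP co] : exists2 c, c \in A & c != o.
  have [ao|] := eqVneq a o; [exists b | exists a] => //.
  by rewrite -ao eq_sym.
have [i ci] : exists i, c i != 0 :> nat.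
  have [/existsP//|/existsPn H] := boolP [exists i, c i != 0 :> nat].
  case: co; apply/ffunP=> i; apply: val_inj.
  by have := H i; rewrite ffunE negbK => /eqP.
by apply/set0Pn; exists (upd c i ord0); apply/mem_shadow; exists c, i.
Qed.

(** Strong induction on [#|S|] supplies the compressions; light [B], two coordinates, and more than
    two are treated separately. *)
Lemma shadow_minS S : shadow_min k S.
Proof.
have [m] := ubnP #|S|; elim: m => // m IHm in S *;
  rewrite ltnS => le_m A B sA iB eqBA.
have [/exists_inP[b0 b0B wb0]|] := boolP [exists b in B, 1 < wt b]; last first.
  move/exists_inPn=> H; apply: shadow_light iB eqBA _ => b bB.
  by rewrite leqNgt; apply: H.
have IH i : i \in S -> shadow_min k (S :\ i).
  by move=> iS; apply: IHm; rewrite (cardsD1 i S) iS in le_m.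
have [A' [sA' eqA' shA' cA']] := ex_compressed IH sA.
apply: leq_trans shA'; rewrite -eqA' in eqBA.
have : 1 < #|S|.
  apply: leq_trans wb0 (subset_leq_card _).
  by have := subsetP iB.1 _ b0B; rewrite inE.
rewrite leq_eqVlt => /predU1P[S2|S3].
  have /cards2P[s [t [st eqS]]] : #|S| == 2 by rewrite -S2.
  move: iB sA' cA'; rewrite eqS => iB sA' cA'.
  case: (ltngtP s t) st => [lt_st _|lt_ts _|/val_inj->]; last by rewrite eqxx.
    exact: shadow_min2 sA' cA' iB eqBA b0B wb0.
  by rewrite setUC in iB sA' cA'; exact: shadow_min2 sA' cA' iB eqBA b0B wb0.
apply: leq_trans (sum_nu_initS iB) (leq_trans _ (sum_nu_le S A')).
(* A point of [A'] of weight at most 1 lies below [b0], hence in [B]. *)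
apply: sum_nu_compressed => // f /setDP[fA fB]; rewrite ltnNge;
  apply: contra fB => wf.
apply: (iB.2 _ _ (subsetP sA' _ fA) b0B); apply/ltnW/key_lt_wt.
exact: leq_ltn_trans wb0.
Qed.

End Main.

Theorem theorem1 (n k : nat) (hn : 0 < n) (hk : 0 < k)
    (A B : {set points k n}) (hB : initial_segment B) (hAB : #|B| = #|A|) :
  #|shadow A| >= #|shadow B|.
Proof.
case: k hk A B hB hAB => // k _ A B hB hAB.
have ptsT (C : {set points k.+1 n}) : C \subset pts k [set: 'I_n].
  by apply/subsetP=> x _; rewrite inE subsetT.
apply: (@shadow_minS k n [set: 'I_n]) => //; split=> // x y _ yB le_xy.
exact: hB yB (key_point_le le_xy).
Qed.
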